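(* Let $U(x)=-e^{-\gamma x}$, $x\in\mathbb R$, with $\gamma>0$, let $n\in\mathbb N$, and let $W_k:S\to(-\infty,0]$ be the functions with $V_k(t,i)=e^{c\gamma t}W_k(i)$. If $q_i\le c\gamma$, then $W_k(i)=-e^{-\gamma g(i)}$ for $k=0,1,\ldots,n-1$ and $\tau^*\equiv0$ is optimal. Now suppose that $q_i>c\gamma$. Then it holds: a) For $(t,i)\in[0,\infty)\times S$ it holds that $W_0(i)=-e^{-\gamma g(i)}$ and for $k=0,1,\ldots,n-1$ $$W_{k+1}(i)=\max\bigg\{-e^{-\gamma g(i)},\ \sum_{j\ne i}\frac{q_{ij}}{q_i-c\gamma}W_k(j)\bigg\}.$$ b) For each $k=0,1,\ldots,n-1$ there exist maximizers $f_k^*:S\to\{0,\infty\}$ (where $f_k^*(i):=0$ if the maximum in the equation in a) is attained in the first expression and $f_k^*(i):=\infty$ if it is attained in the second expression), and the stopping time defined by $$\tau^*=f_0^*(Z_0)1_{\{\tau^*<S_1\}}+\sum_{k=1}^{\infty}\big(f_k^*(Z_k)+S_k\big)1_{\{S_k\le\tau^*<S_{k+1}\}}\quad\mathbb P\text{-a.s.}$$ is optimal for the problem with exponential utility.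
   Context: Markov chain: on a probability space $(\Omega,\mathcal F,\mathbb P)$, $(X_t)_{t\ge0}$ is a right-continuous continuous-time Markov chain with countable state space $S$ and intensity matrix $Q=(q_{ij})$, $0<q_i:=-q_{ii}=\sum_{j\ne i}q_{ij}<\infty$. Its jump times are $0=S_0<S_1<S_2<\dots$, $Z_n:=X_{S_n}$, and $X_t=\sum_{k\ge0}Z_k1_{\{S_k\le t<S_{k+1}\}}$ for all $t\ge0$; $S_{k+1}-S_k\sim\exp(q_{Z_k})$ and $\mathbb P(Z_{k+1}=j\mid Z_k=i)=q_{ij}/q_i$ for $j\ne i$. $(\mathcal F^X_t)$ is the natural filtration of $X$; $\mathbb P_i,\mathbb E_i$ denote probability and expectation given $X_0=i$. $g:S\to\mathbb R$ is a reward function and $c>0$ a cost rate. $\Sigma$ is the set of $(\mathcal F^X_t)$-stopping times $\tau:\Omega\to[0,\infty)$ with $\mathbb P_i(\tau<\infty)=1$ for all $i\in S$. Standing assumptions: (A1) $\sup_{\tau\in\Sigma}\mathbb E_i[g^+(X_\tau)-c\tau]<\infty$ for all $i\in S$; (A2) $\liminf_{n\to\infty}\mathbb E_i[U(g(X_{\tau\wedge S_n})-c(t+\tau\wedge S_n))]\ge\mathbb E_i[U(g(X_\tau)-c(t+\tau))]$ for all $i\in S$, $t\ge0$, $\tau\in\Sigma$. Markovian stopping times: $\Sigma^M$ is the class of Markovian stopping times, i.e. of those $\tau\in\Sigma$ that can be written as $\tau=\tau^01_{\{\tau<S_1\}}+\sum_{k\ge1}\tau^k1_{\{S_k\le\tau<S_{k+1}\}}$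 a.s., where $\tau^k-S_k\ge0$ is a measurable function $h_k$ of the total time elapsed so far and the current state $Z_k$ only. Such a $\tau$ is identified with the sequence $\tau=(h_0,h_1,\dots)$ of measurable maps $h_k:[0,\infty)\times S\to\mathbb R_+$; when a time $t\ge0$ has already elapsed, $\tau^k=h_k(t+S_k,Z_k)+S_k$ for $k\in\mathbb N_0$. Value functions (finite horizon: one has to stop at the latest at the $n$-th jump time $S_n$): $V_n(t,i,\tau):=\mathbb E_i\big[U\big(g(X_{\tau\wedge S_n})-c(t+\tau\wedge S_n)\big)\big]$ with $\tau$ formed with elapsed time $t$, and $V_n(t,i):=\sup_{\tau\in\Sigma^M}V_n(t,i,\tau)$. For the exponential utility the value functions have the form $V_k(t,i)=e^{c\gamma t}W_k(i)$. ''Optimal'' refers to this $n$-jump problem: $V_n(t,i,\tau^* )=V_n(t,i)$. The rules applied from the $n$-th jump on do not affect $\tau^*\wedge S_n$.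
   Formalization: In b), f_k^*, applied after the k-th jump, is taken as a maximizer in the equation for W_{n-k} (n-k jumps remain) instead of W_{k+1}, since with the literal index τ* can fail to be optimal already for n=2; where q_i≤cγ, f_k^*(i)=0. *)

(* Defs.v *)
From HB Require Import structures.
From mathcomp Require Import all_boot all_order all_algebra.
From mathcomp Require Import all_classical all_reals all_analysis.
From mathcomp Require Import measurable_realfun.

Set Implicit Arguments.
Unset Strict Implicit.
Unset Printing Implicit Defensive.

Import Order.TTheory GRing.Theory Num.Theory.
Import numFieldNormedType.Exports.

Local Open Scope classical_set_scope.
Local Open Scope ring_scope.

(* Throughout, the state space S is a measurableType; it is a countable
   discrete space under the hypothesis [countable_discrete S].

   X t w is the state at time t (only t >= 0 matters) and J k w is the k-th
   jump time (J 0 = 0); the embedded chain is Z_k = X_{J k}. *)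

Definition countable_discrete (d : measure_display) (S : measurableType d) :=
  countable [set: S] /\ forall A : set S, measurable A.

(* Unordered sum of a family with values of either sign; [esum] alone is
   meaningful for nonnegative families only. *)
Definition signed_sum (R : realType) (T : choiceType) (D : set T)
    (a : T -> \bar R) : \bar R :=
  (\esum_(j in D) (a^\+ j) - \esum_(j in D) (a^\- j))%E.

Definition exp_utility (R : realType) (gamma x : R) : R := - expR (- gamma * x).

Section intensity.
Context (R : realType) (S : choiceType).
Implicit Type q : S -> S -> R.

Definition rate q (i : S) : R := - q i i.

Definition intensity_matrix q : Prop :=
  [/\ forall i j, j != i -> 0 <= q i j,
      forall i, 0 < rate q i
    & forall i, \esum_(j in [set j | j != i]) (q i j)%:E = (rate q i)%:E].

End intensity.

Section markov_chain.
Context (R : realType) (d d' : measure_display).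
Context (Omega : measurableType d) (S : measurableType d').
Context (P : probability Omega R) (X : R -> Omega -> S) (J : nat -> Omega -> R).

Definition jchain (k : nat) (w : Omega) : S := X (J k w) w.

Definition holding (k : nat) (w : Omega) : R := J k.+1 w - J k w.

(* X is piecewise constant with jump times J, right-continuous, and does not
   explode. *)
Record jump_process : Prop := JumpProcess {
  jp_measX : forall t, 0 <= t -> measurable_fun setT (X t);
  jp_measJ : forall k, measurable_fun setT (J k);
  jp_J0 : forall w, J 0%N w = 0;
  jp_Jlt : forall k w, J k w < J k.+1 w;
  jp_X : forall k w t, J k w <= t < J k.+1 w -> X t w = jchain k w;
  jp_cover : forall w t, 0 <= t -> exists k, J k w <= t < J k.+1 w;
  jp_jump : forall k w, jchain k.+1 w != jchain k w
}.

(* Jump chain / holding time description of a Markov chain with intensity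
   matrix q.  Conditional probabilities are multiplied out, because the
   conditioning events may be null: the first clause says that the jump chain
   is Markov with transition probabilities q i j / q_i (j != i), the second
   that, given Z_0, ..., Z_k, the first k + 1 holding times are independent and
   exponential of parameters q_{Z_0}, ..., q_{Z_k}. *)
Record markov_chain (q : S -> S -> R) : Prop := MarkovChain {
  mc_jump_process :> jump_process;
  mc_jchain : forall (k : nat) (z : nat -> S), z k.+1 != z k ->
    P [set w | forall m, (m <= k.+1)%N -> jchain m w = z m] =
    (P [set w | forall m, (m <= k)%N -> jchain m w = z m] *
     (q (z k) (z k.+1) / rate q (z k))%:E)%E;
  mc_holding : forall (k : nat) (z : nat -> S) (B : nat -> set R),
    (forall m, measurable (B m)) ->
    P [set w | forall m, (m <= k)%N ->
                 jchain m w = z m /\ B m (holding m w)] =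
    (P [set w | forall m, (m <= k)%N -> jchain m w = z m] *
     \prod_(m < k.+1) exponential_prob (rate q (z m)) (B m))%E
}.

Definition start_at (i : S) : set Omega := [set w | X 0 w = i].

(* Elementary conditioning on X_0 = i; junk value if that event is null. *)
Definition Pr_at (i : S) (A : set Omega) : \bar R :=
  ((fine (P (start_at i)))^-1%:E * P (A `&` start_at i))%E.

Definition E_at (i : S) (Y : Omega -> \bar R) : \bar R :=
  ((fine (P (start_at i)))^-1%:E * \int[P]_(w in start_at i) Y w)%E.

Definition natural_filtration (t : R) : set (set Omega) :=
  <<s [set A | exists s B, [/\ 0 <= s, s <= t, measurable B
                             & A = X s @^-1` B]] >>.

Definition Sigma : set (Omega -> \bar R) :=
  [set tau | [/\ forall w, (0 <= tau w)%E,
                 forall t, 0 <= t ->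
                   natural_filtration t [set w | (tau w <= t%:E)%E]
               & forall i, Pr_at i [set w | (tau w < +oo)%E] = 1%E]].

Definition stop_jump (tau : Omega -> \bar R) (n : nat) (w : Omega) : \bar R :=
  mine (tau w) (J n w)%:E.

(* Utility of stopping at sigma when time t has already elapsed; the use of
   [fine] is harmless since sigma is almost surely finite. *)
Definition stop_utility (g : S -> R) (c : R) (U : R -> R) (t : R)
    (sigma : Omega -> \bar R) (w : Omega) : \bar R :=
  (U (g (X (fine (sigma w)) w) - c * (t + fine (sigma w))))%:E.

Definition assumption_A1 (g : S -> R) (c : R) : Prop :=
  forall i : S,
  (ereal_sup [set E_at i (fun w =>
      (Num.max (g (X (fine (tau w)) w)) 0 - c * fine (tau w))%:E)
    | tau in Sigma] < +oo)%E.

Definition assumption_A2 (g : S -> R) (c : R) (U : R -> R) : Prop :=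
  forall (i : S) (t : R) (tau : Omega -> \bar R), 0 <= t -> Sigma tau ->
  (E_at i (stop_utility g c U t tau) <=
   limn_einf (fun n => E_at i (stop_utility g c U t (stop_jump tau n))))%E.

(* A sequence h = (h_0, h_1, ...) of waiting rules, the value +oo meaning "do
   not stop before the next jump". *)
Definition rules := nat -> R -> S -> \bar R.

(* Stopping time formed from h when time t has already elapsed: one stops
   h_k(t + S_k, Z_k) after the k-th jump, for the first k such that this comes
   before the next jump.  Since these times increase with k, the infimum below
   picks the first such k; it is +oo if there is none. *)
Definition markov_time (h : rules) (t : R) (w : Omega) : \bar R :=
  ereal_inf [set ((J k w)%:E + h k (t + J k w)%R (jchain k w))%E
    | k in [set k | (h k (t + J k w)%R (jchain k w) < (holding k w)%:E)%E]].

Definition SigmaM : set rules :=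
  [set h : rules | [/\ forall k s i, (0 <= h k s i)%E,
               forall k, measurable_fun
                 ([set` `[0 : R, +oo[%R] `*` [set: S])
                 (fun p : R * S => h k p.1 p.2)
             & forall t, 0 <= t -> Sigma (markov_time h t)]].

Definition Vof (g : S -> R) (c : R) (U : R -> R)
    (n : nat) (t : R) (i : S) (h : rules) : \bar R :=
  E_at i (stop_utility g c U t (stop_jump (markov_time h t) n)).

Definition V (g : S -> R) (c : R) (U : R -> R)
    (n : nat) (t : R) (i : S) : \bar R :=
  ereal_sup [set Vof g c U n t i h | h in SigmaM].

Definition optimal (g : S -> R) (c : R) (U : R -> R)
    (n : nat) (t : R) (i : S) (h : rules) : Prop :=
  Vof g c U n t i h = V g c U n t i.

Definition value_factor (g : S -> R) (c gamma : R) (W : nat -> S -> R) : Prop :=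
  (forall k i, W k i <= 0) /\
  forall k t i, 0 <= t ->
    V g c (exp_utility gamma) k t i = (expR (c * gamma * t) * W k i)%:E.

End markov_chain.

Section exponential_recursion.
Context (R : realType) (S : choiceType).
Context (q : S -> S -> R) (g : S -> R) (c gamma : R).

Definition stop_value (i : S) : \bar R := (- expR (- gamma * g i))%:E.

Definition continue_value (W : S -> R) (i : S) : \bar R :=
  signed_sum [set j | j != i]
    (fun j => (q i j / (rate q i - c * gamma) * W j)%:E).

(* f k is applied after the k-th jump, when n - k jumps remain; it therefore
   selects a maximizing expression in the equation for W (n - k). *)
Definition maximizers (n : nat) (W : nat -> S -> R) (f : nat -> S -> \bar R) :=
  (forall k i, f k i = 0%E \/ f k i = +oo%E) /\
  forall k i, (k < n)%N ->
    if rate q i <= c * gamma then f k i = 0%E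
    else f k i = 0%E /\ (W (n - k)%N i)%:E = stop_value i \/
         f k i = +oo%E /\ (W (n - k)%N i)%:E = continue_value (W (n - k.+1)%N) i.

Definition stationary_rules (f : nat -> S -> \bar R) : nat -> R -> S -> \bar R :=
  fun k _ i => f k i.

End exponential_recursion.

(* Main.v *)
From HB Require Import structures.
Require Import Defs.
From mathcomp Require Import all_boot all_order all_algebra.
From mathcomp Require Import all_classical all_reals all_analysis.
From mathcomp Require Import measurable_realfun.
From mathcomp Require Import ring.

Set Implicit Arguments.
Unset Strict Implicit.
Unset Printing Implicit Defensive.

Import Order.TTheory GRing.Theory Num.Theory.
Import numFieldNormedType.Exports.

Local Open Scope classical_set_scope.
Local Open Scope ring_scope.

(** Up to its sign the utility of stopping at [sigma] is the cost
    [e^(-gamma g(X_sigma)) * e^(c gamma (t + sigma))], so the elapsed time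
    enters only through a growth factor of rate [beta = c gamma], and the
    problem is to minimise an expected cost by dynamic programming over the
    number of jumps that remain.

    Everything rests on a problem with a single decision.  In a state of rate
    [q], let [G] be the cost of stopping and [b > 0] the expected cost after
    the next jump.  With an exponential holding time [T] of rate [q], the plan
    to stop after a wait [a], unless the jump comes first, costs
      [G * E(e^(beta a); a < T) + b * E(e^(beta T); T <= a)].
    If [beta < q], then [e^(beta s)] turns the exponential density of rate [q]
    into [q / (q - beta)] times the one of rate [q - beta]; a wait [a] thus
    costs a mixture of [G] and [q b / (q - beta)] with weights
    [e^(-(q - beta) a)] and [1 - e^(-(q - beta) a)], which is least at [a = 0]
    or [a = +oo].  If [q <= beta], the first term alone is at least [G] for
    finite [a], while [a = +oo] costs [+oo]; hence one stops at once.  This is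
    [step_value_le], with the extreme cases [step_cost0] and [step_costy].

    To reduce the problem over [n] jumps to this one, the holding time after
    the [k]-th jump has to be integrated out given the past.  The past acts
    only through the event that the rules did not stop before the [k]-th jump,
    the time [J k] and the state [Z k]; [future_independentP] is the Markov
    property for these data, and [ge0_integral_independent_pair] turns it into
    an iterated integral.  The result is [integral_one_step], from which
    induction on the remaining jumps gives that no nonnegative measurable rules
    beat the recursively defined [min_cost] ([min_cost_le]), and that rules
    whose waits are optimal at each single step attain it
    ([min_cost_attained]).

    The supremum over Markovian stopping times has this value because it is
    attained: the optimal waits are [0] or [+oo], so with the value [0] from
    the [n]-th jump on they stop at the first [J k] whose state asks for it.
    This is a finite stopping time, since the jump times and the states they
    lead to can be read off from the path of [X] ([stationary_rules_SigmaM]). *)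

(** * Densities, countable sums and independent pairs *)

Section density.
Local Open Scope ereal_scope.
Context d (T : measurableType d) (R : realType).
Variables (mu nu : {measure set T -> \bar R}) (p : T -> R).
Hypothesis mp : measurable_fun setT p.
Hypothesis p0 : forall x, (0 <= p x)%R.
Hypothesis nuE : forall A, measurable A -> nu A = \int[mu]_(x in A) (p x)%:E.

Import HBNNSimple.

(** Monotone convergence reduces this to simple functions and hence to
    indicators, where it is [nuE]. *)
Lemma ge0_integral_density (f : T -> \bar R) :
  measurable_fun setT f -> (forall x, 0 <= f x) ->
  \int[nu]_x f x = \int[mu]_x (f x * (p x)%:E).
Proof.
move=> mf f0; pose h := nnsfun_approx measurableT mf.
have mpE : measurable_fun setT (EFin \o p) by exact/measurable_EFinP.
have -> : \int[nu]_x f x = lim (\int[nu]_x (h n x)%:E @[n --> \oo]).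
  under eq_integral.
    move=> x _.
    rewrite -(cvg_lim _ (cvg_nnsfun_approx measurableT mf (fun x _ => f0 x) (x := x) _))//.
    over.
  apply: monotone_convergence => //.
  - by move=> n; exact/measurable_EFinP/measurable_funP.
  - by move=> n x _; rewrite lee_fin.
  - by move=> x _ a b ab; rewrite lee_fin; exact/lefP/nd_nnsfun_approx.
have -> : \int[mu]_x (f x * (p x)%:E) =
    lim (\int[mu]_x ((h n x)%:E * (p x)%:E) @[n --> \oo]).
  have E x : f x * (p x)%:E = lim ((h n x)%:E * (p x)%:E @[n --> \oo]).
    by apply/esym/cvg_lim => //; apply: cvgeZr => //; exact: cvg_nnsfun_approx.
  under eq_integral do rewrite E.
  apply: monotone_convergence => //.
  - move=> n; apply: emeasurable_funM => //.
    exact/measurable_EFinP/measurable_funP.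
  - by move=> n x _; rewrite mule_ge0// lee_fin.
  - move=> x _ a b ab; rewrite lee_wpmul2r ?lee_fin//.
    exact/lefP/nd_nnsfun_approx.
apply: congr_lim; apply/funext => n /=.
have mi r : measurable_fun setT (fun x => (r * \1_(h n @^-1` [set r]) x)%:E).
  by apply/measurable_EFinP; exact: measurable_funM.
transitivity (\int[nu]_x
   (\sum_(y \in range (h n)) (y * \1_(h n @^-1` [set y]) x)%:E)).
  by apply: eq_integral => t _; rewrite fimfunE -fsumEFin.
rewrite ge0_integral_fsum//; last by move=> y x _; exact: nnfun_muleindic_ge0.
transitivity (\int[mu]_x (\sum_(y \in range (h n))
    (y * \1_(h n @^-1` [set y]) x)%:E * (p x)%:E)); last first.
  apply: eq_integral => x _; rewrite -ge0_mule_fsuml => [|y].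
    by rewrite fsumEFin// -(fimfunE _ x).
  exact: nnfun_muleindic_ge0.
rewrite [RHS]ge0_integral_fsum//; last 2 first.
  - by move=> y; apply: emeasurable_funM.
  - move=> y x _; apply: mule_ge0; last by rewrite lee_fin.
    exact: nnfun_muleindic_ge0.
apply: eq_fsbigr => r rhn.
have r0 : (0 <= r)%R by move: rhn; rewrite inE => -[t _ <-].
under eq_integral do rewrite EFinM.
rewrite integralZl_indic_nnsfun => //.
under [RHS]eq_integral do rewrite EFinM -muleA.
rewrite [RHS]ge0_integralZl//.
- congr (_ * _); under [RHS]eq_integral do rewrite muleC.
  rewrite [RHS](eq_integral ((EFin \o p) \_ (h n @^-1` [set r]))); last first.
    by move=> x _; rewrite epatch_indic.
  by rewrite -integral_mkcond -nuE// integral_indic// setIT.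
- by apply: emeasurable_funM => //; exact/measurable_EFinP.
- by move=> t _; rewrite mule_ge0 ?lee_fin.
Qed.

End density.

Section esum_scale.
Local Open Scope ereal_scope.

(** The factor may be [+oo]: that is the weight of the next jump when one waits
    for it in a state of rate at most [beta]. *)
Lemma ge0_esumZl (R : realType) (T : choiceType) (D : set T) (k : \bar R)
    (a : T -> \bar R) : 0 <= k -> (forall i, 0 <= a i) ->
  \esum_(i in D) (k * a i) = k * \esum_(i in D) a i.
Proof.
move=> + a0; case: k => [r r0|_|//].
  move: r0; rewrite lee_fin le_eqVlt => /predU1P[<-|r0].
    by rewrite mul0e; apply: esum1 => i _; rewrite mul0e.
  rewrite /esum -ereal_sup_pZl//; congr ereal_sup.
  rewrite image_comp; apply: eq_imagel => A [fA _] /=.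
  by rewrite ge0_mule_fsumr.
have [[i [Di ai]]|ne] := pselect (exists i, D i /\ 0 < a i).
  rewrite gt0_mulye; last first.
    apply: (lt_le_trans ai).
    rewrite -[leLHS](@esum_set1 R T i a)//.
    by apply: esum_ge; exists [set i];
      [split=> // j ->|rewrite esum_set1// fsbig_set1].
  apply/eqP; rewrite -leye_eq; apply: esum_ge; exists [set i].
    by split => // j ->.
  by rewrite fsbig_set1 gt0_mulye.
have aD i : D i -> a i = 0.
  move=> Di; apply/eqP; rewrite eq_le a0 andbT leNgt; apply/negP => ai.
  by apply: ne; exists i.
rewrite [in RHS]esum1// mule0; apply: esum1 => i /aD ->.
by rewrite mule0.
Qed.

End esum_scale.

Section countable_partition.
Local Open Scope ereal_scope.
Context d (T : measurableType d) (R : realType) (S : choiceType).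
Variables (mu : {measure set T -> \bar R}) (Z : T -> S).
Hypothesis cS : countable [set: S].
Hypothesis mZ : forall i, measurable (Z @^-1` [set i]).

(** Numbering the states by an injection into [nat] gives a sequence of disjoint
    pieces of [D], empty at the numbers that are not used. *)
Lemma ge0_integral_countable_partition (D : set T) (f : T -> \bar R) :
  measurable D -> measurable_fun D f -> (forall x, D x -> 0 <= f x) ->
  \int[mu]_(x in D) f x =
  \esum_(i in [set: S]) \int[mu]_(x in D `&` Z @^-1` [set i]) f x.
Proof.
move=> mD mf f0.
have /countable_injP[e einj] := cS.
pose F n := D `&` [set w | e (Z w) = n].
have FE i : F (e i) = D `&` Z @^-1` [set i].
  apply/seteqP; split => w [Dw /= eZ]; split => //=; last by rewrite eZ.
  by apply: einj => //; rewrite inE.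
have F0 n : ~ range e n -> F n = set0.
  by move=> en; rewrite -subset0 => w [_ /= eZ]; apply: en; exists (Z w).
have mF n : measurable (F n).
  have [[i _ <-]|/F0 ->//] := pselect (range e n).
  by rewrite FE; exact: measurableI.
have UF : \bigcup_n F n = D.
  apply/seteqP; split => [w [n _ []]//|w Dw].
  by exists (e (Z w)).
have i0 n : 0 <= \int[mu]_(x in F n) f x.
  by apply: integral_ge0 => x [Dx _]; exact: f0.
rewrite -{1}UF ge0_integral_bigcup//; last 3 first.
- by rewrite UF.
- by rewrite UF.
- by move=> m n _ _ [w [[_ /= <-] [_ /= <-]]].
rewrite nneseries_esumT//.
transitivity (\esum_(n in range e) \int[mu]_(x in F n) f x).
  rewrite [RHS]esum_mkcond; apply: eq_esum => n _.
  by case: ifPn => //; rewrite notin_setE => /F0 ->; rewrite integral_set0.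
rewrite esum_image; last by [].
by apply: eq_esum => i _; rewrite FE.
Qed.

Lemma measure_countable_partition (D : set T) : measurable D ->
  mu D = \esum_(i in [set: S]) mu (D `&` Z @^-1` [set i]).
Proof.
move=> mD; rewrite -[LHS]mul1e -integral_cst//.
rewrite ge0_integral_countable_partition//.
by apply: eq_esum => i _; rewrite integral_cst ?mul1e//; exact: measurableI.
Qed.

(** This freezes the current state: a function of the state and of the outcome
    can be examined one state at a time. *)
Lemma measurable_fun_countable_choice d' (U : measurableType d')
    (f : S -> T -> U) : (forall i, measurable_fun setT (f i)) ->
  measurable_fun setT (fun w => f (Z w) w).
Proof.
move=> mf _ B mB; rewrite setTI.
rewrite (_ : _ @^-1` _ = \bigcup_i (Z @^-1` [set i] `&` f i @^-1` B)).
  apply: countable_bigcupT_measurable => // i; apply: measurableI => //.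
  by rewrite -[X in measurable X]setTI; exact: mf.
apply/seteqP; split => [w Bw|w [i _ [/= <-]]//].
by exists (Z w).
Qed.

End countable_partition.

Section independence.
Local Open Scope ereal_scope.
Context d d1 d2 (T : measurableType d) (T1 : measurableType d1)
  (T2 : measurableType d2) (R : realType).

Lemma integral_mrestr (mu : {measure set T -> \bar R}) (E : set T)
    (mE : measurable E) (f : T -> \bar R) :
  measurable_fun setT f -> (forall x, 0 <= f x) ->
  \int[mrestr mu mE]_x f x = \int[mu]_(x in E) f x.
Proof.
move=> mf f0; rewrite (@ge0_integral_density _ _ _ mu _ (\1_E : T -> R))//.
- by rewrite [RHS]integral_mkcond; apply: eq_integral => x _; rewrite epatch_indic.
- by move=> A mA; rewrite /= /mrestr integral_indic// setIC.
Qed.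

(** The product formula on rectangles determines the joint law, so that Tonelli's
    theorem applies.  Two measures [mu] and [nu] appear because [mu] will be
    restricted to an event about later jumps as well, whose probability is then
    a factor of [nu]. *)
Lemma ge0_integral_independent_pair
    (mu nu : {finite_measure set T -> \bar R}) (th : probability T2 R)
    (Y : T -> T1) (H : T -> T2) (phi : T1 * T2 -> \bar R) :
  measurable_fun setT Y -> measurable_fun setT H ->
  (forall A B, measurable A -> measurable B ->
     mu (Y @^-1` A `&` H @^-1` B) = nu (Y @^-1` A) * th B) ->
  measurable_fun setT phi -> (forall x, 0 <= phi x) ->
  \int[mu]_w phi (Y w, H w) = \int[nu]_w \int[th]_s phi (Y w, s).
Proof.
move=> mY mH E mphi phi0.
have fin1 : fin_num_fun (pushforward nu Y).
  by move=> A mA; apply: fin_num_measure; rewrite -[X in measurable X]setTI; exact: mY.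
pose M0 : {measure set T1 -> \bar R} := pushforward nu Y.
pose m1 : {finite_measure set T1 -> \bar R} :=
  HB.pack_for (FiniteMeasure.type T1 R) (Measure.sort (M0 mY))
    (Measure_isFinite.Build _ _ _ (Measure.sort (M0 mY)) fin1).
have mYH : measurable_fun setT (fun w => (Y w, H w)).
  exact/measurable_fun_pair.
pose m0 : {measure set (T1 * T2) -> \bar R} :=
  pushforward mu (fun w => (Y w, H w)).
transitivity (\int[m0 mYH]_z phi z).
  by rewrite /m0 /= ge0_integral_pushforward.
transitivity (\int[m1 \x th]_z phi z).
  apply: eq_measure_integral => A mA _; apply/esym.
  exact: (product_measure_unique (m' := m0 mYH)).
rewrite fubini_tonelli1// /fubini_F /m1 /M0 /=.
rewrite ge0_integral_pushforward//.
- exact: measurable_fun_fubini_tonelli_F.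
- by move=> y _; exact: integral_ge0.
Qed.

End independence.

(** * Optimal waiting during one exponential holding time *)

Section exponential_step.
Local Open Scope ereal_scope.
Context (R : realType).
Implicit Types (q b r s : R) (a : \bar R).
Notation leb := (@lebesgue_measure R).

(** The measure structure of [exponential_prob q] depends on a proof of [0 < q],
    which is carried along here. *)
Definition exponential_law q (q0 : (0 < q)%R) :
    probability (measurableTypeR R) R :=
  exponential_distribution_exponential_prob__canonical__probability_measure_Probability q0.

Lemma exponential_lawE q (q0 : (0 < q)%R) :
  exponential_law q0 = exponential_prob q :> (set R -> \bar R).
Proof. by []. Qed.

Lemma exponential_prob_le q r : (0 < q)%R -> (0 <= r)%R ->
  exponential_prob q [set s | s <= r]%R = (1 - expR (- q * r))%:E.
Proof.
move=> q0 r0; rewrite /exponential_prob.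
have -> : \int[leb]_(x in [set s | s <= r]%R) (exponential_pdf q x)%:E =
          \int[leb]_(x in `[0%R, r]) (exponential_pdf q x)%:E.
  rewrite [LHS]integral_mkcond [RHS]integral_mkcond; apply: eq_integral => x _.
  rewrite !patchE !mem_setE /= in_itv /=.
  case: (leP 0%R x) => [x0|x0]; first by [].
  by rewrite /= lt0_exponential_pdf//; case: ifP.
move: r0; rewrite le_eqVlt => /predU1P[<-|r0].
  by rewrite set_itv1 integral_set1 mulr0 expR0 subrr.
by rewrite -/(exponential_prob q _) exponential_prob_itv0c.
Qed.

Lemma exponential_prob_gt q r : (0 < q)%R -> (0 <= r)%R ->
  exponential_prob q [set s | r < s]%R = (expR (- q * r))%:E.
Proof.
move=> q0 r0.
have -> : [set s | r < s]%R = ~` [set s | s <= r]%R.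
  apply/seteqP; split => s /=; last by move/negP; rewrite -ltNge.
  by move=> rs; apply/negP; rewrite -ltNge.
rewrite -(exponential_lawE q0) probability_setC//.
  rewrite exponential_lawE exponential_prob_le// -EFinB.
  by rewrite opprB addrC subrK.
have -> : [set s | s <= r]%R = `]-oo, r]%classic.
  by apply/seteqP; split => s /=; rewrite in_itv.
exact: measurable_itv.
Qed.

Lemma integral_exponential_law q (q0 : (0 < q)%R) (f : R -> \bar R) :
  measurable_fun setT f -> (forall x, 0 <= f x) ->
  \int[exponential_law q0]_x f x =
  \int[leb]_x (f x * (exponential_pdf q x)%:E).
Proof.
move=> mf f0; apply: ge0_integral_density => //.
- exact: measurable_exponential_pdf.
- by move=> x; apply: exponential_pdf_ge0; exact: ltW.
Qed.

Variable beta : R.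

(** Growth of the cost over a holding time [s] under the plan to wait [a]:
    [stop_weight] applies if one stops first, [jump_weight] if the jump comes
    first, and the other one vanishes. *)
Definition stop_weight a s : \bar R :=
  if a < s%:E then (expR (beta * fine a))%:E else 0.

Definition jump_weight a s : \bar R :=
  if a < s%:E then 0 else (expR (beta * s))%:E.

Lemma stop_weight_ge0 a s : 0 <= stop_weight a s.
Proof. by rewrite /stop_weight; case: ifP => // _; rewrite lee_fin expR_ge0. Qed.

Lemma jump_weight_ge0 a s : 0 <= jump_weight a s.
Proof. by rewrite /jump_weight; case: ifP => // _; rewrite lee_fin expR_ge0. Qed.

Lemma measurable_lt_EFin d (T : measurableType d) (a : T -> \bar R) (s : T -> R) :
  measurable_fun setT a -> measurable_fun setT s ->
  measurable_fun setT (fun w => a w < (s w)%:E).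
Proof.
by move=> ma ms; apply: measurable_fun_lte => //; exact/measurable_EFinP.
Qed.

Lemma measurable_stop_weight d (T : measurableType d) (a : T -> \bar R) (s : T -> R) :
  measurable_fun setT a -> measurable_fun setT s ->
  measurable_fun setT (fun w => stop_weight (a w) (s w)).
Proof.
move=> ma ms; rewrite /stop_weight; apply: measurable_fun_ifT => //.
  exact: measurable_lt_EFin.
apply/measurable_EFinP; apply: measurableT_comp => //.
by apply: measurable_funM => //; exact: measurableT_comp.
Qed.

Lemma measurable_jump_weight d (T : measurableType d) (a : T -> \bar R) (s : T -> R) :
  measurable_fun setT a -> measurable_fun setT s ->
  measurable_fun setT (fun w => jump_weight (a w) (s w)).
Proof.
move=> ma ms; rewrite /jump_weight; apply: measurable_fun_ifT => //.
  exact: measurable_lt_EFin.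
apply/measurable_EFinP; apply: measurableT_comp => //.
exact: measurable_funM.
Qed.

Lemma integral_stop_weight q (q0 : (0 < q)%R) r : (0 <= r)%R ->
  \int[exponential_law q0]_s stop_weight r%:E s = (expR (- (q - beta) * r))%:E.
Proof.
move=> r0.
transitivity (\int[exponential_law q0]_s ((expR (beta * r))%:E * (\1_[set s | r < s]%R s)%:E)).
  apply: eq_integral => s _; rewrite /stop_weight indicE lte_fin.
  have -> : (s \in [set s | r < s]%R) = (r < s)%R by apply/idP/idP; rewrite inE.
  by case: (r < s)%R => /=; rewrite ?mule1 ?mule0.
have m : measurable ([set s | r < s]%R : set R).
  have -> : [set s | r < s]%R = `]r, +oo[%classic.
    by apply/seteqP; split => s /=; rewrite in_itv /= andbT.
  exact: measurable_itv.
rewrite ge0_integralZl//; last by apply/measurable_EFinP; exact: measurable_indic.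
rewrite integral_indic// setIT.
transitivity ((expR (beta * r))%:E * exponential_prob q [set s | r < s]%R).
  by [].
rewrite exponential_prob_gt//.
by rewrite -EFinM -expRD; congr (expR _)%:E; ring.
Qed.

Lemma integral_stop_weighty q (q0 : (0 < q)%R) :
  \int[exponential_law q0]_s stop_weight +oo s = 0.
Proof. by rewrite integral0_eq// => s _; rewrite /stop_weight. Qed.

(** The change of rate behind the denominators [q - beta]. *)
Lemma jump_weight_density q a s : (beta < q)%R ->
  jump_weight a s * (exponential_pdf q s)%:E =
  (q / (q - beta))%:E *
  ((\1_[set s | ~~ (a < s%:E)%E] s)%:E * (exponential_pdf (q - beta) s)%:E).
Proof.
move=> bq; rewrite /jump_weight indicE.
have -> : (s \in [set s | ~~ (a < s%:E)%E]) = ~~ (a < s%:E)%E.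
  by apply/idP/idP; rewrite inE.
case: (a < s%:E) => /=; first by rewrite !mul0e mule0.
rewrite mul1e -!EFinM; congr _%:E.
have [s0|s0] := leP 0%R s; last by rewrite !lt0_exponential_pdf// !mulr0.
rewrite !exponential_pdfE//.
have d0 : (q - beta != 0)%R by rewrite subr_eq0 gt_eqF.
have -> : (- q * s = - (q - beta) * s - beta * s)%R by ring.
rewrite expRB; field; rewrite d0 /=.
by rewrite gt_eqF// expR_gt0.
Qed.

Lemma integral_jump_weight q (q0 : (0 < q)%R) a : (beta < q)%R ->
  \int[exponential_law q0]_s jump_weight a s =
  (q / (q - beta))%:E * exponential_prob (q - beta) [set s | ~~ (a < s%:E)%E].
Proof.
move=> bq; have l0 : (0 < q - beta)%R by rewrite subr_gt0.
have mE : measurable ([set s | ~~ (a < s%:E)%E] : set R).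
  have := @measurable_lt_EFin _ R (fun=> a) id (measurable_cst _) (@measurable_id _ _ _).
  move=> /(_ measurableT [set false] I); rewrite setTI.
  by congr measurable; apply/seteqP; split => s /=; [move=> ->|move/negbTE].
rewrite integral_exponential_law//; last 2 first.
- exact: measurable_jump_weight.
- by move=> s; exact: jump_weight_ge0.
under eq_integral do rewrite jump_weight_density//.
have mp : measurable_fun setT (EFin \o exponential_pdf (q - beta)).
  by apply/measurable_EFinP; exact: measurable_exponential_pdf.
have p0 s : (0 <= exponential_pdf (q - beta) s)%R.
  by apply: exponential_pdf_ge0; exact: ltW.
rewrite ge0_integralZl//; last first.
- by rewrite lee_fin divr_ge0 ?ltW.
- by move=> s _; rewrite mule_ge0 ?lee_fin.
- by apply: emeasurable_funM => //; apply/measurable_EFinP; exact: measurable_indic.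
congr (_ * _).
under eq_integral do rewrite muleC.
rewrite /exponential_prob [RHS]integral_mkcond.
by apply: eq_integral => s _; rewrite epatch_indic.
Qed.

Lemma integral_jump_weight_fin q (q0 : (0 < q)%R) r : (beta < q)%R -> (0 <= r)%R ->
  \int[exponential_law q0]_s jump_weight r%:E s =
  (q / (q - beta) * (1 - expR (- (q - beta) * r)))%:E.
Proof.
move=> bq r0; rewrite integral_jump_weight// [RHS]EFinM; congr (_ * _).
rewrite -exponential_prob_le ?subr_gt0//; congr (exponential_prob _ _).
by apply/seteqP; split => s /=; rewrite lte_fin -leNgt.
Qed.

Lemma integral_jump_weighty q (q0 : (0 < q)%R) : (beta < q)%R ->
  \int[exponential_law q0]_s jump_weight +oo s = (q / (q - beta))%:E.
Proof.
move=> bq; rewrite integral_jump_weight//.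
rewrite (_ : [set s | _] = setT); last by apply/seteqP; split.
by rewrite /exponential_prob integral_exponential_pdf ?subr_gt0// mule1.
Qed.

(** The integrand [q * expR ((beta - q) * s)] is at least [q] on the whole
    half-line. *)
Lemma integral_jump_weighty_slow q (q0 : (0 < q)%R) : (q <= beta)%R ->
  \int[exponential_law q0]_s jump_weight +oo s = +oo.
Proof.
move=> qb; apply/eqP; rewrite -leye_eq integral_exponential_law//; last 2 first.
- exact: measurable_jump_weight.
- by move=> s; exact: jump_weight_ge0.
have I : \int[leb]_(s in `[0%R, +oo[) q%:E = +oo.
  rewrite integral_cst//= lebesgue_measure_itv /= ltry /=.
  by rewrite addye// gt0_muley.
rewrite -[leLHS]I [leLHS]integral_mkcond; apply: ge0_le_integral => //.
- by move=> s _; rewrite patchE; case: ifP => // _; rewrite lee_fin ltW.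
- by apply/(measurable_restrictT _ _).1 => //; exact: measurable_funTS.
- apply: emeasurable_funM; first exact: measurable_jump_weight.
  by apply/measurable_EFinP; exact: measurable_exponential_pdf.
move=> s _; rewrite patchE mem_setE in_itv /= andbT.
have [s0|s0] := leP 0%R s; last first.
  by rewrite mule_ge0 ?jump_weight_ge0// lee_fin exponential_pdf_ge0// ltW.
rewrite /jump_weight ltNge leey /= -EFinM lee_fin exponential_pdfE//.
rewrite mulrCA -expRD; apply: ler_peMr; first exact: ltW.
by rewrite -[leLHS]expR0 ler_expR -mulrDl mulr_ge0// subr_ge0.
Qed.

(** Expected cost of the plan to wait [a] in a state of rate [q], where stopping
    costs [G] and the expected cost after the next jump is [b]. *)
Definition step_cost q (q0 : (0 < q)%R) (G : R) (b a : \bar R) : \bar R :=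
  G%:E * \int[exponential_law q0]_s stop_weight a s +
  b * \int[exponential_law q0]_s jump_weight a s.

Definition step_value q (G : R) (b : \bar R) : \bar R :=
  if (q <= beta)%R then G%:E else mine G%:E ((q / (q - beta))%:E * b).

(** For [beta < q] the cost of a finite wait [r] is a mixture, with weights
    [x = expR (- (q - beta) * r)] and [1 - x], of the costs of the waits [0] and
    [+oo].  For [q <= beta] the growth beats the chance of a jump: a finite wait
    costs at least [G], and the infinite one costs [+oo] as [0 < b]. *)
Lemma step_value_le q (q0 : (0 < q)%R) (G : R) (b a : \bar R) :
  (0 <= G)%R -> 0 < b -> 0 <= a -> step_value q G b <= step_cost q0 G b a.
Proof.
move=> G0 b0; rewrite /step_value /step_cost.
have J0 : 0 <= \int[exponential_law q0]_s jump_weight a s.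
  by apply: integral_ge0 => s _; exact: jump_weight_ge0.
case: a J0 => [r| |//] J0; last first.
  move=> _; rewrite integral_stop_weighty mule0 add0e.
  case: (leP q beta) => qb.
    by rewrite integral_jump_weighty_slow// gt0_muley// leey.
  by rewrite integral_jump_weighty// muleC ge_min lexx orbT.
rewrite lee_fin => r0; rewrite integral_stop_weight//.
case: (leP q beta) => qb.
  apply: (@le_trans _ _ (G%:E * (expR (- (q - beta) * r))%:E)); last first.
    by rewrite leeDl// mule_ge0// ltW.
  rewrite -EFinM lee_fin; apply: ler_peMr => //; rewrite -[leLHS]expR0 ler_expR.
  by rewrite mulr_ge0// oppr_ge0 subr_le0.
rewrite integral_jump_weight_fin//.
set x := expR _; have x0 : (0 <= x)%R by exact: expR_ge0.
have x1 : (x <= 1)%R.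
  by rewrite /x -expR0 ler_expR mulNr oppr_le0 mulr_ge0// subr_ge0 ltW.
set K := (q / (q - beta))%R; have K0 : (0 < K)%R by rewrite divr_gt0// subr_gt0.
set m := mine _ _.
have mG : m <= G%:E by rewrite /m ge_min lexx.
have mb : m <= K%:E * b by rewrite /m ge_min lexx orbT.
have m0 : 0 <= m by rewrite /m le_min lee_fin G0 mule_ge0 ?lee_fin ?ltW.
have mf : m \is a fin_num by rewrite ge0_fin_numE// (le_lt_trans mG)// ltry.
rewrite EFinM muleA (muleC b).
have {1}-> : m = m * x%:E + m * (1 - x)%:E.
  by rewrite -ge0_muleDr ?lee_fin ?subr_ge0// -EFinD addrC subrK mule1.
by apply: leeD; apply: lee_wpmul2r; rewrite ?lee_fin ?subr_ge0.
Qed.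

Lemma step_cost0 q (q0 : (0 < q)%R) (G : R) (b : \bar R) : (0 <= beta)%R ->
  step_cost q0 G b 0 = G%:E.
Proof.
move=> b0; rewrite /step_cost integral_stop_weight// mulr0 expR0 mule1.
have -> : \int[exponential_law q0]_s jump_weight 0 s = 0; last by rewrite mule0 adde0.
apply/eqP; rewrite eq_le integral_ge0 ?andbT; last by move=> s _; exact: jump_weight_ge0.
have m : measurable ([set s | s <= 0]%R : set R).
  have -> : [set s : R | s <= 0]%R = [set` `]-oo, (0 : R)%R]%R].
    by apply/seteqP; split => s /=; rewrite in_itv.
  exact: measurable_itv.
(* For a zero wait the jump comes first only if [s <= 0], a null event. *)
have E0 : \int[exponential_law q0]_s (\1_[set s | s <= 0]%R s)%:E = 0.
  rewrite integral_indic// setIT.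
  transitivity (exponential_prob q [set s | s <= 0]%R); first by [].
  by rewrite exponential_prob_le// mulr0 expR0 subrr.
rewrite -[leRHS]E0; apply: ge0_le_integral => //.
- by move=> s _; exact: jump_weight_ge0.
- exact: measurable_jump_weight.
- by apply/measurable_EFinP; exact: measurable_indic.
move=> s _; rewrite /jump_weight lte_fin; case: ltP => s0; first by rewrite lee_fin.
rewrite indicE mem_set//= lee_fin -expR0 ler_expR.
by rewrite mulr_ge0_le0.
Qed.

Lemma step_costy q (q0 : (0 < q)%R) (G : R) (b : \bar R) : (beta < q)%R ->
  step_cost q0 G b +oo = (q / (q - beta))%:E * b.
Proof.
move=> bq.
by rewrite /step_cost integral_stop_weighty mule0 add0e integral_jump_weighty// muleC.
Qed.

End exponential_step.

(** * Jump times and states read off from the path *)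

Section jump_times_observed.
Context (R : realType) d (T : measurableType d) (S : choiceType).
Variables (X : R -> T -> S) (J : nat -> T -> R).
Hypothesis cS : countable [set: S].
Hypothesis J0 : forall w, J 0%N w = 0.
Hypothesis Jlt : forall k w, J k w < J k.+1 w.
Hypothesis XJ : forall k w t, J k w <= t < J k.+1 w -> X t w = X (J k w) w.
Hypothesis Xjump : forall k w, X (J k.+1 w) w != X (J k w) w.

Lemma jump_time_mono k l w : (k <= l)%N -> J k w <= J l w.
Proof.
move=> /subnK <-; elim: (l - k)%N => [|m IH]; first by rewrite add0n.
by rewrite addSn (le_trans IH)// ltW.
Qed.

Lemma jump_time_ge0 k w : 0 <= J k w.
Proof. by rewrite -(J0 w) jump_time_mono. Qed.

(** The sigma-algebra of [T] is left open: it may be the one of the whole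
    probability space or the one generated by [X] up to the horizon. *)
Variable horizon : R.
Hypothesis mX : forall s i, 0 <= s <= horizon -> measurable (X s @^-1` [set i]).

(** [None] stands for the time [t], which is observed even if it is irrational. *)
Let observation (t : R) (r : option rat) : R := if r is Some r then ratr r else t.

Let countable_bigcup (I : countType) (F : I -> set T) :
  (forall i, measurable (F i)) -> measurable (\bigcup_i F i).
Proof. by apply: countable_bigcupT_measurable; exact: countableP. Qed.

Let measurable_if (b : bool) (A : set T) :
  (b -> measurable A) -> measurable [set w | b /\ A w].
Proof.
case: b => [mA|_].
  rewrite (_ : [set w | _] = A); first exact: mA.
  by apply/seteqP; split => // w [].
rewrite (_ : [set w | _] = set0)//.
by apply/seteqP; split => // w [].
Qed.

Let measurable_change r s : 0 <= r <= horizon -> 0 <= s <= horizon ->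
  measurable [set w | X r w != X s w].
Proof.
move=> hr hs.
rewrite (_ : [set w | _] =
    ~` \bigcup_i (X r @^-1` [set i] `&` X s @^-1` [set i])).
  apply: measurableC; apply: countable_bigcupT_measurable => // i.
  by apply: measurableI; exact: mX.
apply/seteqP; split => [w /eqP Xrs [i _ [/= ri si]]|w Xrs].
  by apply: Xrs; rewrite ri si.
by apply/eqP => Xrs'; apply: Xrs; exists (X s w).
Qed.

Let pick_observation t k w : J k w <= t ->
  exists r, [/\ J k w <= observation t r, observation t r <= t
             & observation t r < J k.+1 w].
Proof.
move=> Jt; have [tJ|Jt'] := ltP t (J k.+1 w); first by exists None.
have [r] := rat_in_itvoo (Jlt k w); rewrite in_itv /= => /andP[Jr rJ].
by exists (Some r); split => //=; [exact: ltW|exact: le_trans (ltW rJ) Jt'].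
Qed.

(** Consecutive states differ, so [J k.+1 <= t] holds exactly if [X] takes
    different values at two times [r <= s <= t] with [J k <= r].  As [X] is constant
    between jumps, countably many times suffice; [s = t] has to be among them
    because the jump may happen at [t]. *)
Lemma measurable_jump_time_le k t : 0 <= t <= horizon ->
  measurable [set w | J k w <= t].
Proof.
elim: k t => [|k IH] t /andP[t0 th].
  rewrite (_ : [set w | _] = setT)//.
  by apply/seteqP; split => // w _ /=; rewrite J0.
rewrite (_ : [set w | _] = \bigcup_(rs : option rat * option rat)
  [set w | [&& 0 <= observation t rs.1, observation t rs.1 <= observation t rs.2
            & observation t rs.2 <= t] /\
    ([set w | J k w <= observation t rs.1] `&`
     [set w | X (observation t rs.1) w != X (observation t rs.2) w]) w]).
  apply: countable_bigcup => -[r s] /=; apply: measurable_if => /and3P[r0 rs st].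
  have hs : 0 <= observation t s <= horizon.
    by rewrite (le_trans r0 rs) (le_trans st th).
  have hr : 0 <= observation t r <= horizon.
    by rewrite r0 (le_trans rs)//; case/andP: hs.
  by apply: measurableI; [exact: IH|exact: measurable_change].
apply/seteqP; split => [w /= Jt|w [[r s] _ /= [/and3P[r0 rs st] [/= Jr Xrs]]]].
  have [s [Js st sJ]] := pick_observation Jt.
  have [r [Jr _ rJ]] := pick_observation (le_trans (ltW (Jlt k w)) Jt).
  exists (r, s) => //=; split.
    by rewrite (le_trans (jump_time_ge0 k w) Jr) st (ltW (lt_le_trans rJ Js)).
  split => //=.
  have -> : X (observation t r) w = X (J k w) w by apply: XJ; rewrite Jr.
  have -> : X (observation t s) w = X (J k.+1 w) w by apply: XJ; rewrite Js.
  by rewrite eq_sym.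
rewrite leNgt; apply/negP => tJ; move/eqP: Xrs; apply.
have sJ := le_lt_trans st tJ.
transitivity (X (J k w) w); first by apply: XJ; rewrite Jr (le_lt_trans rs).
by apply/esym/XJ; rewrite (le_trans Jr).
Qed.

(** Any observation time between [J k] and [J k.+1] shows the state [X (J k)]. *)
Lemma measurable_jump_state k i t : 0 <= t <= horizon ->
  measurable [set w | J k w <= t /\ X (J k w) w = i].
Proof.
move=> /andP[t0 th].
rewrite (_ : [set w | _] = \bigcup_(r : option rat)
  [set w | (0 <= observation t r <= t) /\
    (([set w | J k w <= observation t r] `\` [set w | J k.+1 w <= observation t r])
     `&` X (observation t r) @^-1` [set i]) w]).
  apply: countable_bigcup => r; apply: measurable_if => /andP[r0 rt].
  have hr : 0 <= observation t r <= horizon by rewrite r0 (le_trans rt th).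
  apply: measurableI; last exact: mX.
  by apply: measurableD; exact: measurable_jump_time_le.
apply/seteqP; split => [w /= [Jt <-]|w [r _ /= [/andP[r0 rt] [[Jr /negP]]]]].
  have [r [Jr rt rJ]] := pick_observation Jt.
  exists r => //=; split; first by rewrite (le_trans (jump_time_ge0 k w) Jr).
  split; first by split => //; apply/negP; rewrite -ltNge.
  by apply: XJ; rewrite Jr.
rewrite -ltNge => rJ <-; split; first exact: le_trans Jr rt.
by apply/esym/XJ; rewrite Jr.
Qed.

End jump_times_observed.

(** * The stopping time defined by waiting rules *)

Section markov_time.
Context (R : realType) d d' (Omega : measurableType d) (S : measurableType d').
Context (P : probability Omega R) (X : R -> Omega -> S) (J : nat -> Omega -> R).
Hypothesis hS : countable_discrete S.
Hypothesis hX : jump_process X J.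

Local Notation Z := (jchain X J).
Local Notation H := (holding J).

Let Jmono k l w : (k <= l)%N -> J k w <= J l w.
Proof. exact: jump_time_mono (jp_Jlt hX) _ _ _. Qed.

Let Jge0 k w : 0 <= J k w.
Proof. exact: jump_time_ge0 (jp_J0 hX) (jp_Jlt hX) _ _. Qed.

Let jp_X' k w t : J k w <= t < J k.+1 w -> X t w = X (J k w) w.
Proof. exact: jp_X hX _ _ _. Qed.

Lemma measurable_jchain k i : measurable (Z k @^-1` [set i]).
Proof.
rewrite (_ : _ @^-1` _ = \bigcup_(n : nat)
    [set w | J k w <= n%:R /\ X (J k w) w = i]).
  apply: bigcupT_measurable => n.
  apply: (measurable_jump_state hS.1 (jp_J0 hX) (jp_Jlt hX) jp_X' (jp_jump hX)
           (horizon := n%:R)) => [s j /andP[s0 _]|]; last by rewrite ler0n lexx.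
  by rewrite -[X in measurable X]setTI; apply: (jp_measX hX s0) => //; exact: hS.2.
apply/seteqP; split => [w /= Zi|w [n _ [_]]//].
exists (Num.trunc (J k w)).+1 => //; split => //.
by rewrite ltW// Num.Theory.truncnS_gt.
Qed.

Lemma natural_filtration_jump_state k i t : 0 <= t ->
  natural_filtration X t [set w | J k w <= t /\ Z k w = i].
Proof.
move=> t0.
pose G := [set A : set Omega | exists s B, [/\ 0 <= s, s <= t, measurable B
                             & A = X s @^-1` B]].
apply: (@measurable_jump_state R _ (g_sigma_algebraType G) S X J hS.1
  (jp_J0 hX) (jp_Jlt hX) jp_X' (jp_jump hX) t) => [s j /andP[s0 st]|].
  by apply: sub_sigma_algebra; exists s, [set j]; split => //; exact: hS.2.
by rewrite t0 lexx.
Qed.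


Section first_stop.
Variables (h : nat -> R -> S -> \bar R) (t : R).
Hypothesis h0 : forall k s i, (0 <= h k s i)%E.

Definition waiting k w : \bar R := h k (t + J k w) (Z k w).

Definition no_stop_before k : set Omega :=
  [set w | forall m, (m < k)%N -> ((H m w)%:E <= waiting m w)%E].

Lemma no_stop_beforeS k w : no_stop_before k w ->
  ((H k w)%:E <= waiting k w)%E -> no_stop_before k.+1 w.
Proof.
by move=> nk Hk m; rewrite ltnS leq_eqVlt => /predU1P[->//|]; exact: nk.
Qed.

Lemma markov_time_ge k w : no_stop_before k w ->
  ((J k w)%:E <= markov_time X J h t w)%E.
Proof.
move=> nk; apply: le_ereal_inf_tmp => _ [m /= hm <-].
rewrite -[leLHS]adde0 leeD//; rewrite lee_fin Jmono// leqNgt.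
by apply/negP => mk; have := nk _ mk; rewrite leNgt hm.
Qed.

(** The candidates of later jumps come after [J k.+1], so the infimum is the
    first one. *)
Lemma markov_time_stop k w : no_stop_before k w ->
  (waiting k w < (H k w)%:E)%E ->
  markov_time X J h t w = ((J k w)%:E + waiting k w)%E.
Proof.
move=> nk hk; apply/eqP; rewrite eq_le; apply/andP; split.
  by apply: ereal_inf_lbound; exists k.
apply: le_ereal_inf_tmp => _ [m /= hm <-].
have km : (k <= m)%N.
  by rewrite leqNgt; apply/negP => mk; have := nk _ mk; rewrite leNgt hm.
move: km; rewrite leq_eqVlt => /predU1P[->//|km].
apply: (@le_trans _ _ (J k.+1 w)%:E).
  have -> : J k.+1 w = J k w + H k w by rewrite /holding addrC subrK.
  by rewrite EFinD leeD2l// ltW.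
by rewrite -[leLHS]adde0 leeD// lee_fin Jmono.
Qed.

End first_stop.

Lemma measurable_stationary_rule (f : S -> \bar R) (D : set (R * S)) :
  measurable_fun D (fun p : R * S => f p.2).
Proof.
apply: measurable_funTS.
have mf : measurable_fun setT f by move=> _ B _; exact: hS.2.
exact: measurableT_comp mf measurable_snd.
Qed.

Lemma measurable_start_at i : measurable (start_at X i).
Proof.
rewrite -[X in measurable X]setTI.
exact: (jp_measX hX (lexx 0) measurableT (hS.2 [set i])).
Qed.

Lemma Pr_at_setT i : (0 < P (start_at X i))%E -> Pr_at P X i setT = 1%E.
Proof.
move=> Pi; rewrite /Pr_at setTI.
have fP : P (start_at X i) \is a fin_num.
  by apply: fin_num_measure; exact: measurable_start_at.
rewrite -[X in (_ * X)%E]fineK// -EFinM mulVf// gt_eqF// fine_gt0// Pi /=.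
by move: fP; rewrite fin_numE ltey => /andP[].
Qed.

(** Such rules stop at the first [J k] with [f k (Z k) = 0], which is at most
    [J n].  Whether this has happened by time [s] depends only on the jumps up to
    [s] and the states reached by them. *)
Lemma stationary_rules_SigmaM (f : nat -> S -> \bar R) (n : nat) :
  (forall i : S, (0 < P (start_at X i))%E) ->
  (forall k i, f k i = 0%E \/ f k i = +oo%E) ->
  (forall i, f n i = 0%E) ->
  SigmaM P X J (stationary_rules f).
Proof.
move=> hstart f0y fn.
have f0 k s i : (0 <= stationary_rules f k s i)%E.
  by rewrite /stationary_rules; case: (f0y k i) => ->.
split => // [k|t t0].
  exact: (measurable_stationary_rule (f k)).
have first w : exists2 k, f k (Z k w) = 0%E & markov_time X J (stationary_rules f) t w = (J k w)%:E.
  pose p k := f k (Z k w) == 0%E.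
  have ep : exists k, p k by exists n; rewrite /p fn.
  case: (ex_minnP ep) => k /eqP fk mink; exists k => //.
  have nk : no_stop_before (stationary_rules f) t k w.
    move=> m mk; rewrite /waiting /stationary_rules.
    case: (f0y m (Z m w)) => [fm|->]; last by rewrite leey.
    by have := mink m; rewrite /p fm eqxx => /(_ isT); rewrite leqNgt mk.
  rewrite (markov_time_stop f0 nk) /waiting /stationary_rules fk ?adde0//.
  by rewrite lte_fin subr_gt0 (jp_Jlt hX).
split => [w|s s0|i].
- by have [k _ ->] := first w; rewrite lee_fin.
- rewrite (_ : [set w | _] = \bigcup_(k : nat) \bigcup_(i : S)
     (if f k i == 0%E then [set w | J k w <= s /\ Z k w = i] else set0)).
    pose G := [set A : set Omega | exists r B, [/\ 0 <= r, r <= s, measurable B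
                             & A = X r @^-1` B]].
    apply: (@bigcupT_measurable _ (g_sigma_algebraType G)) => k.
    apply: (@countable_bigcupT_measurable _ (g_sigma_algebraType G)) => [|i].
      exact: hS.1.
    case: ifP => _; last exact: sigma_algebra0.
    exact: natural_filtration_jump_state.
  apply/seteqP; split => [w /=|w [k _ [i _]]].
    have [k fk ->] := first w; rewrite lee_fin => Js.
    by exists k => //; exists (Z k w) => //; rewrite fk eqxx.
  case: ifP => // /eqP fk [Js Zi] /=.
  apply: le_trans (_ : (J k w)%:E <= _)%E; last by rewrite lee_fin.
  apply: ereal_inf_lbound; exists k => /=; rewrite /stationary_rules Zi fk ?adde0//.
  by rewrite lte_fin subr_gt0 (jp_Jlt hX).
- rewrite (_ : [set w | _] = setT); first exact: Pr_at_setT.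
  by apply/seteqP; split => // w _ /=; have [k _ ->] := first w; rewrite ltry.
Qed.

End markov_time.

(** * Independence of the current holding time from the past *)

Lemma rate_gt0 (R : realType) (S : choiceType) (q : S -> S -> R) :
  intensity_matrix q -> forall i, 0 < rate q i.
Proof. by case. Qed.

Section law_of_one_jump.
Local Open Scope ereal_scope.
Context (R : realType) d d' (Omega : measurableType d) (S : measurableType d').
Context (P : probability Omega R) (X : R -> Omega -> S) (J : nat -> Omega -> R).
Variable q : S -> S -> R.
Hypothesis hS : countable_discrete S.
Hypothesis hq : intensity_matrix q.
Hypothesis hX : markov_chain P X J q.

Local Notation Z := (jchain X J).
Local Notation H := (holding J).

Let hJ : jump_process X J := hX.

Definition jump_prob i j : R := (if j == i then 0 else q i j / rate q i)%R.

Definition holding_law i := exponential_law (rate_gt0 hq i).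

Lemma jump_prob_ge0 i j : (0 <= jump_prob i j)%R.
Proof.
rewrite /jump_prob; case: ifPn => // ji.
by rewrite divr_ge0 ?(ltW (rate_gt0 hq i))//; case: hq => q0 _ _; exact: q0.
Qed.

Lemma measurable_jump_time k : measurable_fun setT (J k).
Proof. exact: (jp_measJ hJ). Qed.

Lemma measurable_holding k : measurable_fun setT (H k).
Proof. by apply: measurable_funB; exact: measurable_jump_time. Qed.

Let mZ k i : measurable (Z k @^-1` [set i]).
Proof. exact: measurable_jchain hS hJ _ _. Qed.

Definition future k L (z : nat -> S) (B : nat -> set R) : set Omega :=
  [set w | forall m, (m <= L)%N -> Z (k + m)%N w = z m /\ B m (H (k + m)%N w)].

(** Conditional probability of [future k L z B] given [Z k = z 0]; it does not
    depend on [k]. *)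
Definition future_weight L (z : nat -> S) (B : nat -> set R) : R :=
  ((\prod_(m < L.+1) fine (exponential_prob (rate q (z m)) (B m))) *
   \prod_(m < L) jump_prob (z m) (z m.+1))%R.

Lemma exponential_prob_fin_num i (B : set R) : measurable B ->
  exponential_prob (rate q i) B \is a fin_num.
Proof. by move=> mB; exact: (fin_num_measure (holding_law i)). Qed.

Lemma future_weight_ge0 L z B : (0 <= future_weight L z B)%R.
Proof.
apply: mulr_ge0; apply: prodr_ge0 => m _; last exact: jump_prob_ge0.
by apply: fine_ge0; exact: (measure_ge0 (holding_law (z m))).
Qed.

Lemma future_weightS L z B :
  future_weight L.+1 z B =
  (fine (exponential_prob (rate q (z 0%N)) (B 0%N)) * jump_prob (z 0%N) (z 1%N)
   * future_weight L (fun m => z m.+1) (fun m => B m.+1))%R.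
Proof.
by rewrite /future_weight big_ord_recl [X in (_ * X)%R]big_ord_recl /=; ring.
Qed.

Lemma measurable_future k L z B : (forall m, measurable (B m)) ->
  measurable (future k L z B).
Proof.
move=> mB.
rewrite (_ : future k L z B =
  \bigcap_(m in [set m | (m <= L)%N]) (Z (k + m)%N @^-1` [set z m] `&` H (k + m)%N @^-1` B m)).
  apply: bigcap_measurableType => m _; apply: measurableI => //.
  by rewrite -[X in measurable X]setTI; exact: measurable_holding.
by apply/seteqP; split => w.
Qed.

Lemma futureS k L z B :
  future k L.+1 z B =
  Z k @^-1` [set z 0%N] `&` H k @^-1` B 0%N `&` future k.+1 L (fun m => z m.+1) (fun m => B m.+1).
Proof.
apply/seteqP; split => w.
  move=> f; split; first by have := f 0%N isT; rewrite addn0.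
  by move=> m mL /=; have := f m.+1 mL; rewrite addnS addSn.
move=> [f0 f] [|m] mL; first by rewrite addn0.
by have := f m mL; rewrite addnS addSn.
Qed.

Lemma path_prob L z :
  P [set w | forall m, (m <= L)%N -> Z m w = z m] =
  P (Z 0%N @^-1` [set z 0%N]) * (\prod_(m < L) jump_prob (z m) (z m.+1))%:E.
Proof.
elim: L => [|L IH].
  rewrite big_ord0 mule1; congr (P _); apply/seteqP; split => w /=.
    by apply.
  by move=> Z0 m; rewrite leqn0 => /eqP ->.
rewrite big_ord_recr/= /jump_prob; have [zz|zz] := eqVneq (z L.+1) (z L).
  rewrite mulr0 mule0 (_ : [set w | _] = set0) ?measure0//.
  rewrite -subset0 => w /= Zw; have := jp_jump hJ L w.
  by rewrite Zw// Zw// zz eqxx.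
by rewrite (mc_jchain hX zz) IH -muleA -EFinM.
Qed.

Lemma future0_prob L z B : (forall m, measurable (B m)) ->
  P (future 0 L z B) = P (Z 0%N @^-1` [set z 0%N]) * (future_weight L z B)%:E.
Proof.
move=> mB; rewrite /future_weight.
have := mc_holding hX L z mB; rewrite path_prob => E.
transitivity (P [set w | forall m, (m <= L)%N -> Z m w = z m /\ B m (H m w)]).
  by congr (P _); apply/seteqP; split.
rewrite E -muleA; congr (_ * _); rewrite mulrC EFinM; congr (_ * _).
rewrite -prodEFin; apply: eq_bigr => m _; rewrite fineK//.
exact: exponential_prob_fin_num.
Qed.

Variables (h : nat -> R -> S -> \bar R) (t : R) (x : S).
Hypothesis mh : forall k i, measurable_fun setT (fun s => h k s i).

Local Notation waiting := (waiting X J h t).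

(** What was decided before the [k]-th jump matters later only through this event,
    the time [J k] and the state [Z k]. *)
Definition running k : set Omega := start_at X x `&` no_stop_before X J h t k.

Let measurable_rule k i : measurable_fun setT (fun u => h k (t + u) i).
Proof.
apply: (measurableT_comp (mh k i)).
by apply: measurable_funD.
Qed.

Lemma measurable_waiting k : measurable_fun setT (waiting k).
Proof.
apply: (@measurable_fun_countable_choice _ _ _ (Z k) hS.1 (mZ k) _ _
  (fun i w => h k (t + J k w) i)) => i.
exact: measurableT_comp (measurable_rule k i) (measurable_jump_time k).
Qed.

Lemma runningS k : running k.+1 =
  running k `&` [set w | ~~ (waiting k w < (H k w)%:E)].
Proof.
apply/seteqP; split => w /=; rewrite -?leNgt.
  move=> [xw nk]; split; last exact: nk.
  by split => // m mk; apply: nk; exact: ltnW.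
by move=> [[xw nk] Hk]; split => //; exact: no_stop_beforeS.
Qed.

Lemma measurable_stop k : measurable [set w | waiting k w < (H k w)%:E].
Proof.
rewrite -[X in measurable X]setTI.
exact: (measurable_lt_EFin (measurable_waiting k) (measurable_holding k)
  measurableT (Y := [set true])).
Qed.

Lemma measurable_running k : measurable (running k).
Proof.
elim: k => [|k IH].
  rewrite (_ : running 0 = start_at X x); first exact: (measurable_start_at hS hJ).
  by apply/seteqP; split => [w []//|w xw]; split.
rewrite runningS; apply: measurableI => //.
rewrite (_ : [set w | _] = ~` [set w | waiting k w < (H k w)%:E]).
  by apply: measurableC; exact: measurable_stop.
by apply/seteqP; split => w /= /negP.
Qed.

(** In the applications [E] is [running k] in a state [i], [E'] adds an event about
    the jumps after the [k]-th, and [r] is the conditional probability of that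
    event. *)
Lemma integral_jump_pair k (E E' : set Omega) (r : R) i :
  measurable E -> measurable E' -> (0 <= r)%R ->
  (forall A B, measurable A -> measurable B ->
     P (E' `&` (J k @^-1` A `&` H k @^-1` B)) =
     r%:E * P (E `&` J k @^-1` A) * exponential_prob (rate q i) B) ->
  forall phi : R * R -> \bar R, measurable_fun setT phi -> (forall y, 0 <= phi y) ->
  \int[P]_(w in E') phi (J k w, H k w) =
  r%:E * \int[P]_(w in E) \int[holding_law i]_s phi (J k w, s).
Proof.
move=> mE mE' r0 PE phi mphi phi0.
have mJH : measurable_fun setT (fun w => (J k w, H k w)).
  by apply/measurable_fun_pair; [exact: measurable_jump_time|exact: measurable_holding].
have mI : measurable_fun setT (fun u : R => \int[holding_law i]_s phi (u, s)).
  exact: (@measurable_fun_fubini_tonelli_F _ _ R _ R (holding_law i) phi).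
have mIJ := measurableT_comp mI (measurable_jump_time k).
have I0 u : 0 <= \int[holding_law i]_s phi (u, s).
  by apply: integral_ge0 => s _; exact: phi0.
rewrite -(integral_mrestr P mE')//; last first.
  exact: measurableT_comp mphi mJH.
rewrite (@ge0_integral_independent_pair _ _ _ _ _ _ _ (mrestr P mE')
  (mscale (NngNum r0) (mrestr P mE)) (holding_law i) (J k) (H k) phi)//.
- rewrite ge0_integral_mscale//.
  by rewrite integral_mrestr.
- exact: measurable_jump_time.
- exact: measurable_holding.
- move=> A B mA mB; rewrite /= /mrestr /mscale /= setIC PE//.
  by rewrite (setIC E).
Qed.


(** The Markov property at the [k]-th jump, for the part of the past that the rules
    use.  Futures of every length are included so that the property can be
    passed from [k] to [k.+1]. *)
Definition future_independent k := forall L (z : nat -> S) (B : nat -> set R) (A : set R),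
  (forall m, measurable (B m)) -> measurable A ->
  P (running k `&` J k @^-1` A `&` future k L z B) =
  P (running k `&` J k @^-1` A `&` Z k @^-1` [set z 0%N]) *
  (future_weight L z B)%:E.

Lemma future0E k z B :
  future k 0 z B = Z k @^-1` [set z 0%N] `&` H k @^-1` B 0%N.
Proof.
apply/seteqP; split => w; first by move=> /(_ 0%N isT); rewrite addn0.
by move=> f [|m]//; rewrite addn0.
Qed.

Lemma future_weight0 z B :
  future_weight 0 z B = fine (exponential_prob (rate q (z 0%N)) (B 0%N)).
Proof. by rewrite /future_weight big_ord0 mulr1 big_ord_recl big_ord0 mulr1. Qed.

(** The property [future_independent k] with a free set for the holding time [H k]
    is the product formula on rectangles for [J k] and [H k]. *)
Lemma integral_holding_future k i L z B (phi : R * R -> \bar R) :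
  future_independent k -> (forall m, measurable (B m)) ->
  measurable_fun setT phi -> (forall y, 0 <= phi y) ->
  \int[P]_(w in running k `&` Z k @^-1` [set i] `&` future k.+1 L z B)
     phi (J k w, H k w) =
  (jump_prob i (z 0%N) * future_weight L z B)%:E *
  \int[P]_(w in running k `&` Z k @^-1` [set i])
     \int[holding_law i]_s phi (J k w, s).
Proof.
move=> fk mB mphi phi0.
have mE : measurable (running k `&` Z k @^-1` [set i]).
  by apply: measurableI => //; exact: measurable_running.
apply: integral_jump_pair => //.
- by apply: measurableI => //; exact: measurable_future.
- by rewrite mulr_ge0 ?jump_prob_ge0 ?future_weight_ge0.
move=> A B0 mA mB0.
pose z' m := if m is m'.+1 then z m' else i.
pose B' m := if m is m'.+1 then B m' else B0.
have mB' m : measurable (B' m) by case: m.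
rewrite (_ : _ `&` _ = running k `&` J k @^-1` A `&` future k L.+1 z' B'); last first.
  rewrite futureS; apply/seteqP; split => w /=.
    by move=> [[[? ?] ?] [? ?]].
  by move=> [[? ?] [[? ?] ?]].
rewrite fk// future_weightS /= [_ `&` _ `&` J k @^-1` A]setIAC.
rewrite -[in RHS](fineK (exponential_prob_fin_num i mB0)) muleC [RHS]muleAC.
by congr (_ * _); rewrite -EFinM; congr _%:E; ring.
Qed.

Lemma integral_holding k i (phi : R * R -> \bar R) : future_independent k ->
  measurable_fun setT phi -> (forall y, 0 <= phi y) ->
  \int[P]_(w in running k `&` Z k @^-1` [set i]) phi (J k w, H k w) =
  \int[P]_(w in running k `&` Z k @^-1` [set i])
     \int[holding_law i]_s phi (J k w, s).
Proof.
move=> fk mphi phi0.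
have mE : measurable (running k `&` Z k @^-1` [set i]).
  by apply: measurableI => //; exact: measurable_running.
rewrite -[RHS]mul1e; apply: integral_jump_pair => //.
move=> A B0 mA mB0; rewrite mul1e.
rewrite (_ : _ `&` _ = running k `&` J k @^-1` A `&`
    future k 0 (fun=> i) (fun=> B0)); last first.
  rewrite future0E; apply/seteqP; split => w /=.
    by move=> [[? ?] [? ?]].
  by move=> [[? ?] [? ?]].
rewrite fk// future_weight0 fineK; last exact: exponential_prob_fin_num.
by rewrite [_ `&` _ `&` J k @^-1` A]setIAC.
Qed.

(** There is no past yet, and this is the description of the chain by its jump
    chain and holding times. *)
Lemma future_independent0 : future_independent 0.
Proof.
move=> L z B A mB mA.
have r0 w : X 0 w = Z 0 w by rewrite /jchain (jp_J0 hJ).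
have [[xz A0]|nA] := pselect (z 0%N = x /\ A 0%R); last first.
  rewrite (_ : _ `&` future _ _ _ _ = set0); last first.
    rewrite -subset0 => w [[[/= xw _] Aw] f]; apply: nA.
    have [<- _] := f 0%N isT; rewrite -r0; split => //.
    by move: Aw; rewrite /= (jp_J0 hJ).
  rewrite (_ : _ `&` (Z 0 @^-1` _) = set0) ?measure0 ?mul0e//.
  rewrite -subset0 => w [[[/= xw _] Aw] /= zw]; apply: nA.
  by rewrite -zw -r0; split => //; move: Aw; rewrite /= (jp_J0 hJ).
rewrite (_ : _ `&` future _ _ _ _ = future 0 L z B); last first.
  apply/seteqP; split => [w []//|w f]; split => //; split; last by rewrite /= (jp_J0 hJ).
  by split => //; rewrite /start_at /= r0; have [-> _] := f 0%N isT.
rewrite future0_prob//; congr (P _ * _); apply/seteqP; split => [w zw|w []//].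
split => //; split; last by rewrite /= (jp_J0 hJ).
by split => //; rewrite /start_at /= r0 zw.
Qed.

(** Given [Z k = i], both [running k.+1] and [J k.+1] are functions of [J k] and
    [H k], and this pair is independent of the future after jump [k.+1] except
    for the factor [jump_prob i (z 0)].  Hence both sides split over [i] into
    the same terms [Q i A], the right-hand side being the case of a future
    that prescribes only the state [z 0]. *)
Lemma future_independentS k : future_independent k -> future_independent k.+1.
Proof.
move=> fk.
pose C i (A : set R) := [set y : R * R |
   ~~ (h k (t + y.1)%R i < y.2%:E) /\ A (y.1 + y.2)%R].
have mC i A : measurable A -> measurable (C i A).
  move=> mA; apply: measurableI.
    rewrite -[X in measurable X]setTI.
    have m1 : measurable_fun setT (fun y : R * R => h k (t + y.1)%R i).
      exact: measurableT_comp (measurable_rule k i) measurable_fst.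
    have := measurable_lt_EFin m1 (@measurable_snd _ _ R R).
    move=> /(_ measurableT [set false] I); congr measurable.
    by apply/seteqP; split => y /=; [move=> [_ ->]|move=> [_ /negbTE]].
  rewrite -[X in measurable X]setTI.
  have m1 : measurable_fun setT (fun y : R * R => (y.1 + y.2)%R).
    by apply: measurable_funD; [exact: measurable_fst|exact: measurable_snd].
  exact: m1.
pose Q i A := \int[P]_(w in running k `&` Z k @^-1` [set i])
     \int[holding_law i]_s (\1_(C i A) (J k w, s))%:E.
have Q0 i A : 0 <= Q i A.
  by apply: integral_ge0 => w _; apply: integral_ge0 => s _; rewrite lee_fin.
have E L z B A i : (forall m, measurable (B m)) -> measurable A ->
   P (running k.+1 `&` J k.+1 @^-1` A `&` future k.+1 L z B `&` Z k @^-1` [set i])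
   = (jump_prob i (z 0%N) * future_weight L z B)%:E * Q i A.
  move=> mB mA.
  have mE : measurable (running k `&` Z k @^-1` [set i] `&` future k.+1 L z B).
    apply: measurableI; last exact: measurable_future.
    by apply: measurableI => //; exact: measurable_running.
  have mJH : measurable_fun setT (fun w => (J k w, H k w)).
    by apply/measurable_fun_pair; [exact: measurable_jump_time|exact: measurable_holding].
  rewrite -(@integral_holding_future k i L z B (fun y => (\1_(C i A) y)%:E) fk mB); last 2 first.
  - by apply/measurable_EFinP; apply: measurable_indic; exact: mC.
  - by move=> y; rewrite lee_fin.
  transitivity (\int[P]_(w in running k `&` Z k @^-1` [set i] `&` future k.+1 L z B)
     (\1_((fun w => (J k w, H k w)) @^-1` C i A) w)%:E); last by [].
  rewrite integral_indic//; last first.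
    by rewrite -[X in measurable X]setTI; apply: mJH => //; exact: mC.
  congr (P _); rewrite runningS; apply/seteqP; split => w /=.
    move=> [[[[rw nw] Aw] fw] iw]; split; last by [].
    by rewrite /waiting iw in nw; split => //=; rewrite /holding addrC subrK.
  move=> [[nw Aw] [[rw iw] fw]]; split => //; split => //; split.
    by split => //; rewrite /waiting iw.
  by move: Aw; rewrite /= /holding addrC subrK.
move=> L z B A mB mA.
have mR A' : measurable A' -> measurable (running k.+1 `&` J k.+1 @^-1` A').
  move=> mA'; apply: measurableI; first exact: measurable_running.
  by rewrite -[X in measurable X]setTI; exact: (measurable_jump_time k.+1).
rewrite (measure_countable_partition P hS.1 (mZ k)); last first.
  by apply: measurableI; [exact: mR|exact: measurable_future].
rewrite [in RHS](measure_countable_partition P hS.1 (mZ k)); last first.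
  by apply: measurableI => //; exact: mR.
rewrite muleC -ge0_esumZl//; last by rewrite lee_fin future_weight_ge0.
apply: eq_esum => i _; apply: (etrans (E L z B A i mB mA)).
rewrite (_ : Z k.+1 @^-1` [set z 0%N] = future k.+1 0 z (fun=> setT)); last first.
  by rewrite future0E setIT.
transitivity ((future_weight L z B)%:E *
    ((jump_prob i (z 0%N) * future_weight 0 z (fun=> setT))%:E * Q i A)); last first.
  by congr (_ * _); exact/esym/(E 0%N z (fun=> setT) A i (fun=> measurableT) mA).
rewrite future_weight0 (_ : exponential_prob _ _ = 1); last first.
  exact: (probability_setT (holding_law (z 0%N))).
by rewrite mulr1 muleA -EFinM mulrC.
Qed.

Lemma future_independentP k : future_independent k.
Proof. by elim: k => [|k IH]; [exact: future_independent0|exact: future_independentS]. Qed.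

End law_of_one_jump.

(** * Dynamic programming over the remaining jumps *)

Section dynamic_programming.
Local Open Scope ereal_scope.
Context (R : realType) d d' (Omega : measurableType d) (S : measurableType d').
Context (P : probability Omega R) (X : R -> Omega -> S) (J : nat -> Omega -> R).
Variable q : S -> S -> R.
Hypothesis hS : countable_discrete S.
Hypothesis hq : intensity_matrix q.
Hypothesis hX : markov_chain P X J q.

Local Notation Z := (jchain X J).
Local Notation H := (holding J).

Let hJ : jump_process X J := hX.
Let rate_pos i : (0 < rate q i)%R := rate_gt0 hq i.
Let mZ k i : measurable (Z k @^-1` [set i]).
Proof. exact: measurable_jchain hS hJ _ _. Qed.

Variables (G : S -> R) (beta : R).
Hypothesis G0 : forall i, (0 < G i)%R.

Definition expected_cost (v : S -> R) i : \bar R :=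
  \esum_(j in [set: S]) (jump_prob q i j * v j)%:E.

(** Least expected cost with [l] jumps left, for elapsed time [0]. *)
Fixpoint min_cost (l : nat) (i : S) : R :=
  if l is l'.+1 then
    fine (step_value beta (rate q i) (G i) (expected_cost (min_cost l') i))
  else G i.

(** Some transition out of [i] is possible, since their rates add up to
    [rate q i > 0].  Strict positivity makes an infinite wait in a state of rate
    at most [beta] infinitely costly. *)
Lemma expected_cost_gt0 v i : (forall j, 0 < v j)%R -> 0 < expected_cost v i.
Proof.
move=> v0.
have p0 := jump_prob_ge0 hq.
have [[j pj]|np] := pselect (exists j, 0 < jump_prob q i j)%R.
  apply: (@lt_le_trans _ _ (jump_prob q i j * v j)%:E).
    by rewrite lte_fin mulr_gt0.
  apply: esum_ge; exists [set j]; first by split => // ? ->.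
  by rewrite fsbig_set1.
have : \esum_(j in [set j | j != i]) (q i j)%:E = 0.
  apply: esum1 => j /= ji; congr _%:E; apply/eqP; rewrite eq_le.
  have [q0 _ _] := hq; rewrite (q0 i j ji) andbT leNgt; apply/negP => qj.
  by apply: np; exists j; rewrite /jump_prob (negbTE ji) divr_gt0.
have [_ _ ->] := hq; move=> [ri].
by have := rate_pos i; rewrite ri ltxx.
Qed.

Lemma step_value_gt0 i b : 0 < b -> 0 < step_value beta (rate q i) (G i) b.
Proof.
move=> b0; rewrite /step_value; case: (leP (rate q i) beta) => qb; first by rewrite lte_fin.
rewrite lt_min lte_fin G0 /=; apply: mule_gt0 => //.
by rewrite lte_fin divr_gt0// subr_gt0.
Qed.

Lemma step_value_fin_num i b : 0 < b ->
  step_value beta (rate q i) (G i) b \is a fin_num.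
Proof.
move=> b0; rewrite ge0_fin_numE ?ltW ?step_value_gt0//.
rewrite /step_value; case: (leP (rate q i) beta) => qb; first exact: ltry.
by rewrite gt_min ltry.
Qed.

Lemma min_cost_gt0 l i : (0 < min_cost l i)%R.
Proof.
elim: l i => [|l IH] i /=; first exact: G0.
have b0 := expected_cost_gt0 i IH.
by rewrite fine_gt0// step_value_gt0//= ltey_eq step_value_fin_num.
Qed.

Lemma min_costS l i : (min_cost l.+1 i)%:E =
  step_value beta (rate q i) (G i) (expected_cost (min_cost l) i).
Proof.
rewrite /= fineK// step_value_fin_num// expected_cost_gt0//.
exact: min_cost_gt0.
Qed.

Variables (h : nat -> R -> S -> \bar R) (t : R) (x : S).
Hypothesis h0 : forall k s i, 0 <= h k s i.
Hypothesis mh : forall k i, measurable_fun setT (fun s => h k s i).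

Local Notation waiting := (waiting X J h t).
Local Notation running := (running X J h t x).

Definition time_factor k w : R := expR (beta * (t + J k w)).

(** Cost along a path that was not stopped before the [k]-th jump, if one has to
    stop at the latest [l] jumps later. *)
Fixpoint cost (l k : nat) (w : Omega) : R :=
  if l is l'.+1 then
    if waiting k w < (H k w)%:E
    then (G (Z k w) * (time_factor k w * expR (beta * fine (waiting k w))))%R
    else cost l' k.+1 w
  else (G (Z k w) * time_factor k w)%R.

Lemma measurable_jchain_comp k d0 (U : measurableType d0) (f : S -> U) :
  measurable_fun setT (fun w => f (Z k w)).
Proof.
exact: (@measurable_fun_countable_choice _ _ _ (Z k) hS.1 (mZ k) _ _
  (fun i _ => f i)).
Qed.

Lemma measurable_time_factor k : measurable_fun setT (time_factor k).
Proof.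
apply: measurableT_comp => //; apply: measurable_funM => //.
by apply: measurable_funD => //; exact: measurable_jump_time hX k.
Qed.

Let mw k : measurable_fun setT (waiting k).
Proof. exact: (measurable_waiting hS hX t mh). Qed.

Let mH k : measurable_fun setT (H k).
Proof. exact: (measurable_holding hX). Qed.

Let mrun k : measurable (running k).
Proof. exact: (measurable_running hS hX t x mh). Qed.

Let time_factor_gt0 k w : (0 < time_factor k w)%R. Proof. exact: expR_gt0. Qed.

Lemma measurable_cost l k : measurable_fun setT (cost l k).
Proof.
elim: l k => [|l IH] k /=.
  by apply: measurable_funM; [exact: measurable_jchain_comp|exact: measurable_time_factor].
apply: measurable_fun_ifT => //.
  exact: measurable_lt_EFin.
apply: measurable_funM; first exact: measurable_jchain_comp.
apply: measurable_funM; first exact: measurable_time_factor.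
apply: measurableT_comp => //; apply: measurable_funM => //.
exact: measurableT_comp.
Qed.

Lemma cost_ge0 l k w : (0 <= cost l k w)%R.
Proof.
elim: l k => [|l IH] k /=; first by rewrite mulr_ge0 ?ltW.
by case: ifP => // _; rewrite !mulr_ge0 ?expR_ge0 ?ltW.
Qed.

(** The cost of the [k]-th holding time, split according to whether one stops in it
    or reaches the next jump, where the cost [v] of the new state is charged. *)
Definition stop_part k w : \bar R :=
  (G (Z k w) * time_factor k w)%:E * stop_weight beta (waiting k w) (H k w).

Definition jump_part k (v : S -> R) w : \bar R :=
  (v (Z k.+1 w) * time_factor k w)%:E * jump_weight beta (waiting k w) (H k w).

Let mstop k : measurable_fun setT (stop_part k).
Proof.
apply: emeasurable_funM; last exact: measurable_stop_weight.
apply/measurable_EFinP; apply: measurable_funM; first exact: measurable_jchain_comp.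
exact: measurable_time_factor.
Qed.

Let mjump k v : measurable_fun setT (jump_part k v).
Proof.
apply: emeasurable_funM; last exact: measurable_jump_weight.
apply/measurable_EFinP; apply: measurable_funM; last exact: measurable_time_factor.
exact: measurable_jchain_comp.
Qed.

Let stop_part_ge0 k w : 0 <= stop_part k w.
Proof. by rewrite mule_ge0 ?stop_weight_ge0// lee_fin mulr_ge0 ?ltW. Qed.

Let jump_part_ge0 k v w : (forall j, 0 <= v j)%R -> 0 <= jump_part k v w.
Proof.
move=> v0; apply: mule_ge0; last exact: jump_weight_ge0.
by rewrite lee_fin mulr_ge0// ltW.
Qed.

Let integral_runningS k (f : Omega -> \bar R) :
  \int[P]_(w in running k.+1) f w =
  \int[P]_(w in running k) (if waiting k w < (H k w)%:E then 0 else f w).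
Proof.
rewrite runningS setIC [LHS]integral_mkcondl; apply: eq_integral => w _.
rewrite patchE; case: ifPn => [/set_mem /= /negbTE -> //|].
by rewrite notin_setE /= => /negP; rewrite negbK => ->.
Qed.

Lemma integral_costS l k :
  \int[P]_(w in running k) (cost l.+1 k w)%:E =
  \int[P]_(w in running k) stop_part k w +
  \int[P]_(w in running k.+1) (cost l k.+1 w)%:E.
Proof.
rewrite integral_runningS -ge0_integralD//.
- apply: eq_integral => w _; rewrite /= /stop_part /stop_weight.
  case: ifP => _; last by rewrite mule0 add0e.
  by rewrite adde0 -EFinM mulrA.
- exact: measurable_funTS.
- by move=> w _; case: ifP => _; rewrite lee_fin// cost_ge0.
- apply: measurable_funTS; apply: measurable_fun_ifT => //.
    exact: measurable_lt_EFin.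
  by apply/measurable_EFinP; exact: measurable_cost.
Qed.

Lemma integral_next_value k v :
  \int[P]_(w in running k.+1) (v (Z k.+1 w) * time_factor k.+1 w)%:E =
  \int[P]_(w in running k) jump_part k v w.
Proof.
rewrite integral_runningS; apply: eq_integral => w _.
rewrite /jump_part /jump_weight; case: ifP => _; first by rewrite mule0.
rewrite -EFinM -mulrA /time_factor -expRD; congr (_ * expR _)%:E.
by rewrite /holding; ring.
Qed.

Local Notation law i := (holding_law hq i).

Let measurable_stop_integral i :
  measurable_fun setT (fun a => \int[law i]_s stop_weight beta a s).
Proof.
apply: (@measurable_fun_fubini_tonelli_F _ _ (\bar R) _ R (law i)
  (fun y : \bar R * R => stop_weight beta y.1 y.2)).
  by apply: measurable_stop_weight; [exact: measurable_fst|exact: measurable_snd].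
by move=> y; exact: stop_weight_ge0.
Qed.

Let measurable_jump_integral i :
  measurable_fun setT (fun a => \int[law i]_s jump_weight beta a s).
Proof.
apply: (@measurable_fun_fubini_tonelli_F _ _ (\bar R) _ R (law i)
  (fun y : \bar R * R => jump_weight beta y.1 y.2)).
  by apply: measurable_jump_weight; [exact: measurable_fst|exact: measurable_snd].
by move=> y; exact: jump_weight_ge0.
Qed.

Let stop_integral_ge0 i a : 0 <= \int[law i]_s stop_weight beta a s.
Proof. by apply: integral_ge0 => s _; exact: stop_weight_ge0. Qed.

Let jump_integral_ge0 i a : 0 <= \int[law i]_s jump_weight beta a s.
Proof. by apply: integral_ge0 => s _; exact: jump_weight_ge0. Qed.

Let mrule k i : measurable_fun setT (fun y : R * R => h k (t + y.1)%R i).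
Proof.
apply: (measurableT_comp (mh k i)).
by apply: measurable_funD => //; exact: measurable_fst.
Qed.

Let mtime_factor2 (r : R) :
  measurable_fun setT (fun y : R * R => (r * expR (beta * (t + y.1)))%:E).
Proof.
apply/measurable_EFinP; apply: measurable_funM => //.
apply: measurableT_comp => //; apply: measurable_funM => //.
by apply: measurable_funD => //; exact: measurable_fst.
Qed.

Lemma integral_stop_part k i :
  \int[P]_(w in running k `&` Z k @^-1` [set i]) stop_part k w =
  \int[P]_(w in running k `&` Z k @^-1` [set i])
    ((time_factor k w)%:E *
     ((G i)%:E * \int[law i]_s stop_weight beta (waiting k w) s)).
Proof.
pose phi (y : R * R) : \bar R :=
  (G i * expR (beta * (t + y.1)))%:E * stop_weight beta (h k (t + y.1)%R i) y.2.
transitivity (\int[P]_(w in running k `&` Z k @^-1` [set i]) phi (J k w, H k w)).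
  apply: eq_integral => w /set_mem[_ /= iw].
  by rewrite /stop_part /phi /waiting /time_factor iw.
rewrite (integral_holding hS hq hX mh i (future_independentP hS hq hX t x mh k)); last 2 first.
- by apply: emeasurable_funM => //; apply: measurable_stop_weight => //; exact: measurable_snd.
- by move=> y; apply: mule_ge0; rewrite ?stop_weight_ge0// lee_fin mulr_ge0 ?expR_ge0// ltW.
apply: eq_integral => w /set_mem[_ /= iw]; rewrite /phi /= ge0_integralZl//.
- by rewrite /waiting iw muleA -EFinM mulrC.
- by apply: measurable_stop_weight => //; exact: measurable_cst.
- by move=> s _; exact: stop_weight_ge0.
- by rewrite lee_fin mulr_ge0 ?expR_ge0// ltW.
Qed.

(** The holding time and the next state are independent, so the cost after the
    jump is averaged into [expected_cost v i]. *)
Lemma integral_jump_part k i v : (forall j, 0 <= v j)%R ->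
  \int[P]_(w in running k `&` Z k @^-1` [set i]) jump_part k v w =
  \int[P]_(w in running k `&` Z k @^-1` [set i])
    ((time_factor k w)%:E *
     (expected_cost v i * \int[law i]_s jump_weight beta (waiting k w) s)).
Proof.
move=> v0.
have mE : measurable (running k `&` Z k @^-1` [set i]) by exact: measurableI.
have b0 : 0 <= expected_cost v i.
  by apply: esum_ge0 => j _; rewrite lee_fin mulr_ge0// jump_prob_ge0.
have mdJ : measurable_fun setT (fun w => (time_factor k w)%:E *
    \int[law i]_s jump_weight beta (waiting k w) s).
  apply: emeasurable_funM; first by apply/measurable_EFinP; exact: measurable_time_factor.
  exact: measurableT_comp (measurable_jump_integral i) (mw k).
have dJ0 w : 0 <= (time_factor k w)%:E * \int[law i]_s jump_weight beta (waiting k w) s.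
  by rewrite mule_ge0// lee_fin ltW.
rewrite (@ge0_integral_countable_partition _ _ _ _ P (Z k.+1) hS.1 (mZ k.+1))//; last 2 first.
- exact: measurable_funTS.
- by move=> w _; exact: jump_part_ge0.
under [RHS]eq_integral do rewrite muleCA.
rewrite [RHS]ge0_integralZl//; last exact: measurable_funTS.
rewrite muleC /expected_cost -ge0_esumZl//; last 2 first.
- by apply: integral_ge0.
- by move=> j; rewrite lee_fin mulr_ge0// jump_prob_ge0.
apply: eq_esum => j _.
pose phi (y : R * R) : \bar R :=
  (v j * expR (beta * (t + y.1)))%:E * jump_weight beta (h k (t + y.1)%R i) y.2.
transitivity (\int[P]_(w in running k `&` Z k @^-1` [set i] `&`
    future X J k.+1 0 (fun=> j) (fun=> setT)) phi (J k w, H k w)).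
  rewrite future0E setIT; apply: eq_integral => w /set_mem[[_ /= iw] /= jw].
  by rewrite /jump_part /phi /waiting /time_factor iw jw.
rewrite (integral_holding_future hS hq hX mh i _ _
  (future_independentP hS hq hX t x mh k))//; last 2 first.
- by apply: emeasurable_funM => //; apply: measurable_jump_weight => //; exact: measurable_snd.
- by move=> y; apply: mule_ge0; rewrite ?jump_weight_ge0// lee_fin mulr_ge0// expR_ge0.
rewrite future_weight0 (_ : exponential_prob _ _ = 1); last first.
  exact: (probability_setT (law j)).
rewrite mulr1 [RHS]muleC EFinM -muleA; congr (_ * _).
rewrite -ge0_integralZl//; [|exact: measurable_funTS|by rewrite lee_fin].
apply: eq_integral => w /set_mem[_ /= iw]; rewrite /phi /= ge0_integralZl//.
- by rewrite /waiting iw muleA -EFinM.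
- by apply: measurable_jump_weight => //; exact: measurable_cst.
- by move=> s _; exact: jump_weight_ge0.
- by rewrite lee_fin mulr_ge0// expR_ge0.
Qed.

(** With the state [i] at the [k]-th jump fixed and the holding time integrated
    out, the one-step problem of that state is left. *)
Lemma integral_one_step k v : (forall j, 0 <= v j)%R ->
  \int[P]_(w in running k) stop_part k w + \int[P]_(w in running k) jump_part k v w =
  \esum_(i in [set: S]) \int[P]_(w in running k `&` Z k @^-1` [set i])
    ((time_factor k w)%:E *
     step_cost beta (rate_gt0 hq i) (G i) (expected_cost v i) (waiting k w)).
Proof.
move=> v0.
rewrite (@ge0_integral_countable_partition _ _ _ _ P (Z k) hS.1 (mZ k) _
  (stop_part k))//; last first.
  exact: measurable_funTS.
rewrite (@ge0_integral_countable_partition _ _ _ _ P (Z k) hS.1 (mZ k) _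
  (jump_part k v))//; last 2 first.
- exact: measurable_funTS.
- by move=> w _; exact: jump_part_ge0.
rewrite -esumD//; last 2 first.
- by move=> i _; exact: integral_ge0.
- by move=> i _; apply: integral_ge0 => w _; exact: jump_part_ge0.
apply: eq_esum => i _; rewrite integral_stop_part integral_jump_part//.
have b0 : 0 <= expected_cost v i.
  by apply: esum_ge0 => j _; rewrite lee_fin mulr_ge0// jump_prob_ge0.
have mE : measurable (running k `&` Z k @^-1` [set i]) by exact: measurableI.
have md : measurable_fun setT (fun w => (time_factor k w)%:E).
  by apply/measurable_EFinP; exact: measurable_time_factor.
rewrite -ge0_integralD//.
- apply: eq_integral => w _; rewrite -ge0_muleDr//; last 2 first.
    by rewrite mule_ge0// lee_fin ltW.
  by rewrite mule_ge0.
- by move=> w _; rewrite !mule_ge0// lee_fin ltW.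
- apply: measurable_funTS; apply: emeasurable_funM => //.
  apply: measurable_funeM.
  exact: measurableT_comp (measurable_stop_integral i) (mw k).
- by move=> w _; rewrite !mule_ge0// lee_fin ltW.
- apply: measurable_funTS; apply: emeasurable_funM => //.
  apply: measurable_funeM.
  exact: measurableT_comp (measurable_jump_integral i) (mw k).
Qed.

Lemma waiting_ge0 k w : 0 <= waiting k w.
Proof. exact: h0. Qed.

Let integral_value_partition k v : (forall j, 0 <= v j)%R ->
  \int[P]_(w in running k) (v (Z k w) * time_factor k w)%:E =
  \esum_(i in [set: S]) \int[P]_(w in running k `&` Z k @^-1` [set i])
    ((time_factor k w)%:E * (v i)%:E).
Proof.
move=> v0; rewrite (@ge0_integral_countable_partition _ _ _ _ P (Z k) hS.1 (mZ k))//.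
- apply: eq_esum => i _; apply: eq_integral => w /set_mem[_ /= ->].
  by rewrite -EFinM mulrC.
- apply: measurable_funTS; apply/measurable_EFinP; apply: measurable_funM.
    exact: measurable_jchain_comp.
  exact: measurable_time_factor.
- by move=> w _; rewrite lee_fin mulr_ge0// ltW.
Qed.

Let min_cost_ge0 l i : (0 <= min_cost l i)%R.
Proof. exact/ltW/min_cost_gt0. Qed.

(** Induction backwards from the last jump: the costs after the next jump are
    bounded by the induction hypothesis, and [step_value_le] then applies at
    each state and elapsed time. *)
Lemma min_cost_le l k :
  \int[P]_(w in running k) (min_cost l (Z k w) * time_factor k w)%:E <=
  \int[P]_(w in running k) (cost l k w)%:E.
Proof.
elim: l k => [|l IH] k; first by [].
rewrite integral_costS.
apply: (@le_trans _ _ (\int[P]_(w in running k) stop_part k w +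
  \int[P]_(w in running k.+1) (min_cost l (Z k.+1 w) * time_factor k.+1 w)%:E)); last first.
  exact: leeD2l.
rewrite integral_next_value integral_one_step// integral_value_partition//.
apply: le_esum => i _; apply: ge0_le_integral.
- exact: measurableI.
- by move=> w _; rewrite mule_ge0 ?lee_fin// ltW.
- apply: measurable_funTS; apply: emeasurable_funM => //.
  by apply/measurable_EFinP; exact: measurable_time_factor.
- apply: measurable_funTS; apply: emeasurable_funM.
    by apply/measurable_EFinP; exact: measurable_time_factor.
  apply: emeasurable_funD; apply: measurable_funeM.
    exact: measurableT_comp (measurable_stop_integral i) (mw k).
  exact: measurableT_comp (measurable_jump_integral i) (mw k).
- move=> w _; apply: lee_wpmul2l; first by rewrite lee_fin ltW.
  rewrite min_costS; apply: step_value_le; [exact: ltW| |exact: waiting_ge0].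
  by apply: expected_cost_gt0 => j; exact: min_cost_gt0.
Qed.

(** The computation of [min_cost_le], with an equality at each step. *)
Lemma min_cost_attained l k :
  (forall m s i, (m < l)%N ->
     step_cost beta (rate_gt0 hq i) (G i)
       (expected_cost (min_cost (l - m.+1)) i) (h (k + m)%N s i) =
     (min_cost (l - m) i)%:E) ->
  \int[P]_(w in running k) (cost l k w)%:E =
  \int[P]_(w in running k) (min_cost l (Z k w) * time_factor k w)%:E.
Proof.
elim: l k => [|l IH] k hk; first by [].
rewrite integral_costS IH; last first.
  by move=> m s i ml; have := hk m.+1 s i ml; rewrite addnS !subSS.
rewrite integral_next_value integral_one_step// integral_value_partition//.
apply: eq_esum => i _; apply: eq_integral => w /set_mem[_ /= iw].
congr (_ * _); have := hk 0%N (t + J k w)%R i isT.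
by rewrite subSS !subn0 addn0 /waiting iw.
Qed.

End dynamic_programming.

(** * Exponential utility *)

Section exponential_utility.
Context (R : realType) d d' (Omega : measurableType d) (S : measurableType d').
Context (P : probability Omega R) (X : R -> Omega -> S) (J : nat -> Omega -> R).
Variables (q : S -> S -> R) (g : S -> R) (c gamma : R).
Hypothesis hS : countable_discrete S.
Hypothesis hq : intensity_matrix q.
Hypothesis hX : markov_chain P X J q.
Hypothesis hstart : forall i : S, (0 < P (start_at X i))%E.
Hypothesis hc : 0 < c.
Hypothesis hgamma : 0 < gamma.

Local Notation Z := (jchain X J).
Local Notation H := (holding J).
Local Notation beta := (c * gamma).

Let hJ : jump_process X J := hX.
Let beta0 : 0 < beta. Proof. exact: mulr_gt0. Qed.

Definition stop_cost (i : S) : R := expR (- gamma * g i).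

Let G0 i : 0 < stop_cost i. Proof. exact: expR_gt0. Qed.

Local Notation U := (exp_utility gamma).
Local Notation mcost := (min_cost q stop_cost beta).

Lemma exp_utility_cost i t s :
  U (g i - c * (t + s)) = - (stop_cost i * expR (beta * (t + s))).
Proof. by rewrite /exp_utility /stop_cost -expRD; congr (- expR _); ring. Qed.

Let Jmono k l w : (k <= l)%N -> J k w <= J l w.
Proof. exact: (jump_time_mono (jp_Jlt hJ)). Qed.

Section given_rules.
Variables (h : nat -> R -> S -> \bar R) (t : R).
Hypothesis h0 : forall k s i, (0 <= h k s i)%E.

(** Before a stop the rules behave as if started at the [k]-th jump, which allows
    an induction on the number of jumps that are left. *)
Lemma stop_utility_cost l k w : no_stop_before X J h t k w ->
  stop_utility X g c U t (stop_jump J (markov_time X J h t) (k + l)) w =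
  (- cost X J stop_cost beta h t l k w)%:E.
Proof.
elim: l k => [|l IH] k nk /=.
  rewrite addn0 /stop_utility /stop_jump min_r; last exact: (markov_time_ge hJ h0 nk).
  by rewrite /= exp_utility_cost.
case: ifPn => [hk|].
  have wf : waiting X J h t k w \is a fin_num.
    by rewrite ge0_fin_numE ?(lt_trans hk) ?ltry//; exact: h0.
  have w0 : 0 <= fine (waiting X J h t k w) by apply: fine_ge0; exact: h0.
  have wH : fine (waiting X J h t k w) < H k w by rewrite -lte_fin fineK.
  have E : (markov_time X J h t w = (J k w + fine (waiting X J h t k w))%:E)%E.
    by rewrite (markov_time_stop hJ h0 nk hk) EFinD fineK.
  have tJ : J k w + fine (waiting X J h t k w) < J k.+1 w.
    by rewrite -ltrBrDl.
  rewrite /stop_utility /stop_jump E min_l; last first.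
    by rewrite lee_fin ltW// (lt_le_trans tJ)// Jmono// addnS ltnS leq_addr.
  rewrite /= (jp_X hJ (k := k)); last by rewrite tJ lerDl w0.
  by rewrite exp_utility_cost addrA mulrDr expRD.
rewrite -leNgt => Hk; rewrite addnS -addSn; apply: IH.
exact: no_stop_beforeS.
Qed.

Hypothesis mh : forall k i, measurable_fun setT (fun s => h k s i).

Lemma Vof_cost n x :
  Vof P X J g c U n t x h =
  (- ((fine (P (start_at X x)))^-1%:E *
     \int[P]_(w in running X J h t x 0) (cost X J stop_cost beta h t n 0 w)%:E))%E.
Proof.
have r0 : running X J h t x 0 = start_at X x.
  by apply/seteqP; split => [w []//|w xw]; split.
rewrite /Vof /E_at -muleN -integral_ge0N r0; last first.
  by move=> w _; rewrite lee_fin cost_ge0.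
congr (_ * _)%E; apply: eq_integral => w _.
by rewrite -[n]add0n stop_utility_cost.
Qed.

Lemma integral_min_cost_start n x :
  ((fine (P (start_at X x)))^-1%:E *
   \int[P]_(w in running X J h t x 0) (mcost n (Z 0%N w) * time_factor J beta t 0 w)%:E
   = (expR (beta * t) * mcost n x)%:E)%E.
Proof.
have r0 : running X J h t x 0 = start_at X x.
  by apply/seteqP; split => [w []//|w xw]; split.
have mx := measurable_start_at hS hJ x.
have fx : P (start_at X x) \is a fin_num by exact: fin_num_measure.
have p0 : 0 < fine (P (start_at X x)).
  by rewrite fine_gt0// hstart/= ltey_eq fx.
rewrite r0 (eq_integral (fun=> (expR (beta * t) * mcost n x)%:E)); last first.
  move=> w /set_mem xw; rewrite /time_factor (jp_J0 hJ) addr0 mulrC.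
  by rewrite /jchain (jp_J0 hJ) [X 0 w]xw.
rewrite integral_cst// -[X in (_ * (_ * X))%E]fineK// -!EFinM; congr _%:E.
by field; rewrite gt_eqF.
Qed.

End given_rules.

Lemma Vof_le h n t x : (forall k s i, (0 <= h k s i)%E) ->
  (forall k i, measurable_fun setT (fun s => h k s i)) ->
  (Vof P X J g c U n t x h <= (expR (beta * t) * - mcost n x)%:E)%E.
Proof.
move=> h0 mh; rewrite Vof_cost// mulrN EFinN leeN2 -(integral_min_cost_start h t).
apply: lee_wpmul2l; first by rewrite lee_fin invr_ge0 fine_ge0.
exact: min_cost_le.
Qed.

(** Admissible rules are measurable on nonnegative times only.  Giving them their
    value at [0] on negative times makes them measurable everywhere and
    changes nothing along the paths. *)
Lemma Vof_SigmaM_le h n t x : 0 <= t -> SigmaM P X J h ->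
  (Vof P X J g c U n t x h <= (expR (beta * t) * - mcost n x)%:E)%E.
Proof.
move=> t0 [h0 mh _].
pose h' k s i := h k (Num.max 0 s) i.
have hh' k w : h k (t + J k w) (Z k w) = h' k (t + J k w) (Z k w).
  by rewrite /h' max_r// addr_ge0// (jump_time_ge0 (jp_J0 hJ) (jp_Jlt hJ)).
have -> : Vof P X J g c U n t x h = Vof P X J g c U n t x h'.
  rewrite /Vof; congr (E_at P X x (stop_utility X g c U t (stop_jump J _ n))).
  apply/funext => w; congr ereal_inf.
  by apply/seteqP; split => _ [k /= hk <-]; exists k; rewrite /= ?hh'// -hh'.
apply: Vof_le => [k s i|k i]; first exact: h0.
have mp : measurable_fun setT (fun s : R => (Num.max 0 s, i)).
  apply/measurable_fun_pair => //.
  by apply: measurable_maxr.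
apply: (measurable_comp _ _ (mh k) mp).
  by apply: measurableX => //; exact: measurable_itv.
by move=> _ [s _ <-]; split => //=; rewrite in_itv/= andbT le_max lexx.
Qed.


(** All terms of the sum are nonpositive, so only its negative part is left. *)
Lemma continue_valueE v i : (forall j, 0 <= v j) -> beta < rate q i ->
  continue_value q c gamma (fun j => - v j) i =
  (- ((rate q i / (rate q i - beta))%:E * expected_cost q v i))%E.
Proof.
move=> v0 bi; have ri := rate_gt0 hq i.
have d0 : 0 < rate q i - beta by rewrite subr_gt0.
have p0 j := jump_prob_ge0 hq i j.
rewrite /continue_value /signed_sum esum1 ?sub0e; last first.
  move=> j /= ji; rewrite funeposE max_r// lee_fin mulrN oppr_le0 mulr_ge0//.
  by rewrite divr_ge0 ?(ltW d0)//; have [q0 _ _] := hq; exact: q0.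
congr (- _)%E; rewrite /expected_cost -ge0_esumZl; last 2 first.
- by rewrite lee_fin divr_ge0 ?ltW.
- by move=> j; rewrite lee_fin mulr_ge0.
rewrite esum_mkcond; apply: eq_esum => j _.
rewrite -EFinM; case: ifPn => [/set_mem /= ji|].
  rewrite funenegE max_l; last first.
    rewrite -EFinN lee_fin mulrN opprK mulr_ge0//.
    by rewrite divr_ge0 ?(ltW d0)//; have [q0 _ _] := hq; exact: q0.
  rewrite -EFinN mulrN opprK /jump_prob (negbTE ji); congr _%:E.
  by field; rewrite !gt_eqF.
rewrite notin_setE /= => /negP; rewrite negbK => /eqP ->.
by rewrite /jump_prob eqxx mul0r mulr0.
Qed.

Lemma min_cost_slow k i : rate q i <= beta -> mcost k i = stop_cost i.
Proof.
move=> ri; case: k => [//|k]; apply: EFin_inj.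
by rewrite (min_costS hq)// /step_value ri.
Qed.

Lemma min_cost_continue k i : beta < rate q i ->
  (- mcost k.+1 i)%:E = maxe (- stop_cost i)%:E
    (continue_value q c gamma (fun j => - mcost k j) i).
Proof.
move=> bi; rewrite EFinN (min_costS hq)// /step_value leNgt bi /=.
rewrite continue_valueE// => [|j]; last by apply/ltW/(min_cost_gt0 hq).
by rewrite oppe_min.
Qed.

Section maximizing_rules.
Variable W : nat -> S -> R.
Hypothesis WE : forall k i, W k i = - mcost k i.

Let W_fun k : W k = (fun j => - mcost k j).
Proof. by apply/funext => j; rewrite WE. Qed.

Lemma Vof_maximizers n t x f : maximizers q g c gamma n W f ->
  Vof P X J g c U n t x (stationary_rules f) = (expR (beta * t) * W n x)%:E.
Proof.
move=> [f0y fmax].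
have f0 k s i : (0 <= stationary_rules f k s i)%E.
  by rewrite /stationary_rules; case: (f0y k i) => ->.
rewrite Vof_cost// WE mulrN EFinN -(integral_min_cost_start (stationary_rules f) t).
congr (- (_ * _))%E; apply: (min_cost_attained hS (hq := hq) hX) => //.
move=> m s i mn; rewrite add0n /stationary_rules.
have nm : (n - m = (n - m.+1).+1)%N by rewrite subnSK.
have := fmax m i mn; case: ifPn => [ri ->|].
  by rewrite step_cost0 ?ltW// min_cost_slow.
rewrite -ltNge => bi [[-> Wstop]|[-> Wcont]].
  rewrite step_cost0 ?ltW//; apply: oppe_inj.
  by rewrite -EFinN -[RHS]EFinN -WE Wstop.
rewrite step_costy//; apply: oppe_inj.
rewrite -[RHS]EFinN -WE Wcont W_fun continue_valueE// => j.
exact/ltW/(min_cost_gt0 hq).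
Qed.

(** The value [0] from the [n]-th jump on makes the stopping time finite. *)
Lemma exists_maximizers n : exists f : nat -> S -> \bar R,
  maximizers q g c gamma n W f /\ forall k i, (n <= k)%N -> f k i = 0%E.
Proof.
pose f k i : \bar R := if [&& (k < n)%N, beta < rate q i
  & W (n - k)%N i != - stop_cost i] then +oo%E else 0%E.
exists f; split; last by move=> k i nk; rewrite /f ltnNge nk.
split => [k i|k i kn]; first by rewrite /f; case: ifP => _; [right|left].
rewrite /f kn /= ltNge; case: (leP (rate q i) beta) => //= bi.
have [Ws|Ws] := eqVneq (W (n - k)%N i) (- stop_cost i).
  by left; rewrite Ws.
right; split => //.
have nk : (n - k = (n - k.+1).+1)%N by rewrite subnSK.
have E : (W (n - k)%N i)%:E = maxe (- stop_cost i)%:E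
    (continue_value q c gamma (W (n - k.+1)%N) i).
  by rewrite WE W_fun nk min_cost_continue.
move: E; rewrite maxEle; case: ifP => // _ [E].
by rewrite E eqxx in Ws.
Qed.

End maximizing_rules.

Lemma V_min_cost n t x : 0 <= t ->
  V P X J g c U n t x = (expR (beta * t) * - mcost n x)%:E.
Proof.
move=> t0; apply/eqP; rewrite eq_le; apply/andP; split.
  by apply: ge_ereal_sup => _ [h hh <-]; exact: Vof_SigmaM_le.
have [f [fm fn]] := exists_maximizers (W := fun k i => - mcost k i) (fun _ _ => erefl) n.
rewrite -(Vof_maximizers (fun _ _ => erefl) t x fm).
apply: ereal_sup_ubound; exists (stationary_rules f) => //.
case: fm => f0y _; apply: (stationary_rules_SigmaM hS hJ (n := n)) => // i.
exact: fn.
Qed.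

Lemma Vof_stop_at_once n t x :
  Vof P X J g c U n t x (fun _ _ _ => 0%E) =
  (expR (beta * t) * - stop_cost x)%:E.
Proof.
rewrite Vof_cost// mulrN EFinN -(integral_min_cost_start (fun _ _ _ => 0%E) t 0).
congr (- (_ * _))%E; apply: eq_integral => w _; congr _%:E.
case: n => [//|n]; rewrite /= /waiting lte_fin subr_gt0 (jp_Jlt hJ).
by rewrite mulr0 expR0 mulr1.
Qed.

End exponential_utility.

Theorem theorem4p8
  (R : realType) (d d' : measure_display)
  (Omega : measurableType d) (S : measurableType d')
  (P : probability Omega R) (X : R -> Omega -> S) (J : nat -> Omega -> R)
  (q : S -> S -> R) (g : S -> R) (c gamma : R) (n : nat)
  (hS : countable_discrete S)
  (hq : intensity_matrix q)
  (hX : markov_chain P X J q)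
  (hstart : forall i : S, (0 < P (start_at X i))%E)
  (hc : 0 < c) (hgamma : 0 < gamma) (hn : (0 < n)%N)
  (hA1 : assumption_A1 P X g c)
  (hA2 : assumption_A2 P X J g c (exp_utility gamma)) :
  (exists W : nat -> S -> R, value_factor P X J g c gamma W) /\
  forall W : nat -> S -> R, value_factor P X J g c gamma W ->
  [/\ (* states with q_i <= c gamma *)
      forall i : S, rate q i <= c * gamma ->
        [/\ forall k : nat, (k < n)%N -> W k i = - expR (- gamma * g i),
            SigmaM P X J (fun _ _ _ => 0%E)
          & forall t : R, 0 <= t ->
              optimal P X J g c (exp_utility gamma) n t i (fun _ _ _ => 0%E)],
      (* a) *)
      forall i : S, c * gamma < rate q i ->
        W 0%N i = - expR (- gamma * g i) /\
        forall k : nat, (k < n)%N ->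
          (W k.+1 i)%:E =
          maxe (- expR (- gamma * g i))%:E
               (signed_sum [set j | j != i]
                  (fun j => (q i j / (rate q i - c * gamma) * W k j)%:E))
    & (* b) *)
      (exists f : nat -> S -> \bar R, maximizers q g c gamma n W f) /\
      forall f : nat -> S -> \bar R, maximizers q g c gamma n W f ->
        ((forall (k : nat) (i : S), (n <= k)%N -> f k i = 0%E) ->
           SigmaM P X J (stationary_rules f)) /\
        forall (t : R) (i : S), 0 <= t ->
          optimal P X J g c (exp_utility gamma) n t i (stationary_rules f)].
Proof.
have hJ : jump_process X J := hX.
pose m := min_cost q (stop_cost g gamma) (c * gamma).
have VE k t i : 0 <= t ->
    V P X J g c (exp_utility gamma) k t i = (expR (c * gamma * t) * - m k i)%:E.
  exact: V_min_cost.
split.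
  exists (fun k i => - m k i); split => [k i|k t i t0]; last exact: VE.
  by rewrite oppr_le0; apply/ltW/(min_cost_gt0 hq) => j; exact: expR_gt0.
move=> W [_ WV].
have WE k i : W k i = - m k i.
  have := WV k 0 i (lexx 0); rewrite VE// mulr0 expR0 !mul1r.
  by move=> [->].
have W_fun k : W k = (fun j => - m k j) by apply/funext => j; rewrite WE.
split.
- move=> i ri; split=> [k _||t t0].
  + by rewrite WE /m min_cost_slow.
  + apply: (@stationary_rules_SigmaM _ _ _ _ _ P X J hS hJ (fun _ _ => 0%E) 0) => //.
    by move=> k j; left.
  + by rewrite /optimal VE// (Vof_stop_at_once g c gamma hS hX)// /m min_cost_slow.
- move=> i ri; split=> [|k _]; first by rewrite WE.
  by rewrite WE W_fun /m min_cost_continue.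
split.
  have [f [fm _]] := exists_maximizers hq WE n.
  by exists f.
move=> f fm; split=> [fn|t i t0].
  case: (fm) => f0y _; apply: (stationary_rules_SigmaM hS hJ (n := n)) => // i.
  exact: fn.
by rewrite /optimal (Vof_maximizers hS hq hX hstart hc hgamma WE)// VE// WE.
Qed.
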